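(* Every connected totally umbilical hypersurface $M^m$ of a Kähler manifold or a Sasakian manifold has constant mean curvature.
   Context: A hypersurface $M^m$ of a Riemannian manifold $(\widetilde M^{m+1},\widetilde g)$ (with induced metric) with local unit normal $\nu$ and Weingarten map $\mathrm{II}X=-\widetilde\nabla_X\nu$ (where $\widetilde\nabla$ is the Levi-Civita connection of $\widetilde g$) has mean curvature $H=\frac1m\mathrm{tr}(\mathrm{II})$ (defined locally, up to the sign given by the choice of $\nu$). It is totally umbilical if $\mathrm{II}X=HX$ for all tangent vectors $X$ of $M$. Constant mean curvature means $dH=0$ on $M$.
   Formalization: The hypothesis m ≥ 4 on the dimension of the hypersurface is added; without it the claim is false, since m = 1 (plane curves in C), m = 2 (Sasakian 3-manifolds) and m = 3 (Kähler surfaces of real dimension 4) all have counterexamples. *)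

(* Defs.v *)
From HB Require Import structures.
From mathcomp Require Import all_boot all_order all_algebra.
From mathcomp Require Import all_classical all_reals all_analysis.

Set Implicit Arguments.
Unset Strict Implicit.
Unset Printing Implicit Defensive.

Import Order.TTheory GRing.Theory Num.Theory.
Import numFieldNormedType.Exports.
Local Open Scope classical_set_scope.
Local Open Scope ring_scope.

(* Real analysis is over an arbitrary R : realType.  Vectors of R^n are row
   vectors, 'e_i is the i-th vector of the standard basis, and a linear map
   acts on the right of row vectors by its matrix. *)

Section Smooth.
Context {R : realType} {n : nat}.
Implicit Types (U : set 'rV[R]_n) (f : 'rV[R]_n -> R).

Definition ebase (i : 'I_n) : 'rV[R]_n := delta_mx 0 i.

(* f is C^k on U; U is open in all uses *)
Fixpoint Ck_on (k : nat) U f : Prop :=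
  (forall x, U x -> {for x, continuous f}) /\
  match k with
  | 0 => True
  | k'.+1 => forall i : 'I_n,
      (forall x, U x -> derivable f x (ebase i)) /\
      Ck_on k' U (fun x => 'D_(ebase i) f x)
  end.

Definition smooth_on U f : Prop := forall k, Ck_on k U f.

End Smooth.

Notation "''e_' i" := (ebase i) (at level 8, i at level 2, format "''e_' i").

(* The values of crd outside dom and of crdV outside cod are irrelevant. *)
Record chart (R : realType) (n : nat) (T : topologicalType) := Chart {
  dom : set T;
  cod : set 'rV[R]_n;
  crd : T -> 'rV[R]_n;
  crdV : 'rV[R]_n -> T;
  dom_open : open dom;
  cod_open : open cod;
  crd_cod : forall p, dom p -> cod (crd p);
  crdV_dom : forall x, cod x -> dom (crdV x);
  crdK : forall p, dom p -> crdV (crd p) = p;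
  crdVK : forall x, cod x -> crd (crdV x) = x;
  crd_continuous : forall p, dom p -> {for p, continuous crd};
  crdV_continuous : forall x, cod x -> {for x, continuous crdV}
}.

(* f, seen in the chart c, is smooth on the part of W covered by c *)
Definition smooth_in (R : realType) (n : nat) (T : topologicalType)
    (c : chart R n T) (W : set T) (f : T -> R) : Prop :=
  smooth_on (crd c @` (dom c `&` W)) (f \o crdV c).

(* Smooth n-manifolds without boundary, given by a smooth atlas *)
Record manifold (R : realType) (n : nat) := Manifold {
  points :> topologicalType;
  points_hausdorff : hausdorff_space points;
  points_second_countable : @second_countable points;
  atlas : Type;
  chart_of : atlas -> chart R n points;
  atlas_cover : forall p : points, exists c, dom (chart_of c) p;
  atlas_smooth : forall (c d : atlas) (j : 'I_n),
    smooth_in (chart_of c) (dom (chart_of d))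
      (fun q => crd (chart_of d) q 0 j)
}.

Section Coordinates.
Context {R : realType} {n : nat}.

(* the i-th coordinate derivative of f at p, in the chart c *)
Definition pd (T : topologicalType) (c : chart R n T) (i : 'I_n) (f : T -> R)
    (p : T) : R :=
  'D_('e_i) (f \o crdV c) (crd c p).

(* d^j differentiated along the i-th coordinate of c.  A tangent vector at p
   with components v in the chart c has components v *m jac c d p in d. *)
Definition jac (N : manifold R n) (c d : atlas N) (p : N) : 'M[R]_n :=
  \matrix_(i, j) pd (chart_of c) i (fun q => crd (chart_of d) q 0 j) p.

Definition ip (G : 'M[R]_n) (v w : 'rV[R]_n) : R := (v *m G *m w^T) 0 0.

End Coordinates.

(* Tensor fields are given by their components in each chart c of the atlas,
   as functions of the point p (relevant for p in dom c), subject to the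
   transformation law of the tensor type. *)

(* metr c p is the Gram matrix g(d_i, d_j) *)
Record metric (R : realType) (n : nat) (N : manifold R n) := Metric {
  metr :> atlas N -> N -> 'M[R]_n;
  metr_smooth : forall c i j,
    smooth_in (chart_of c) [set: N] (fun p => metr c p i j);
  metr_sym : forall c p, dom (chart_of c) p -> (metr c p)^T = metr c p;
  metr_pos : forall c p (v : 'rV[R]_n),
    dom (chart_of c) p -> v != 0 -> 0 < ip (metr c p) v v;
  metr_change : forall c d p, dom (chart_of c) p -> dom (chart_of d) p ->
    metr c p = jac c d p *m metr d p *m (jac c d p)^T
}.

(* christ c p i j is the vector nabla_(d_i) d_j.  The last two fields say that
   nabla has no torsion and that nabla g = 0; they determine christ on dom c,
   whence its smoothness and the change of charts rule of a connection. *)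
Record levi_civita (R : realType) (n : nat) (N : manifold R n) (g : metric N) :=
  LeviCivita {
  christ : atlas N -> N -> 'I_n -> 'I_n -> 'rV[R]_n;
  torsion_free : forall c p i j, dom (chart_of c) p ->
    christ c p i j = christ c p j i;
  metric_compat : forall c p k i j, dom (chart_of c) p ->
    pd (chart_of c) k (fun q => g c q i j) p =
      ip (g c p) (christ c p k i) 'e_j + ip (g c p) 'e_i (christ c p k j)
}.

Section Structures.
Context {R : realType} {n : nat} {N : manifold R n} {g : metric N}.
Variable D : levi_civita g.

(* nabla_(d_k) Y for a vector field with components Y in the chart c *)
Definition covd (c : atlas N) (k : 'I_n) (Y : N -> 'rV[R]_n) (p : N)
    : 'rV[R]_n :=
  \row_j pd (chart_of c) k (fun q => Y q 0 j) p
  + \sum_(i < n) Y p 0 i *: christ D c p k i.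

(* (nabla_(d_k) A) d_i = nabla_(d_k) (A d_i) - A (nabla_(d_k) d_i), for a field
   of endomorphisms A, whose row i is A d_i *)
Definition covd_endo (c : atlas N) (k : 'I_n) (A : N -> 'M[R]_n) (p : N)
    (i : 'I_n) : 'rV[R]_n :=
  covd c k (fun q => row i (A q)) p - christ D c p k i *m A p.

(* J is a g-orthogonal almost complex structure with nabla J = 0 *)
Record kahler_structure (J : atlas N -> N -> 'M[R]_n) : Prop := {
  kahler_smooth : forall c i j,
    smooth_in (chart_of c) [set: N] (fun p => J c p i j);
  kahler_change : forall c d p, dom (chart_of c) p -> dom (chart_of d) p ->
    J c p *m jac c d p = jac c d p *m J d p;
  kahler_sqr : forall c p, dom (chart_of c) p -> J c p *m J c p = - 1%:M;
  kahler_orth : forall c p, dom (chart_of c) p ->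
    J c p *m g c p *m (J c p)^T = g c p;
  kahler_parallel : forall c k i p, dom (chart_of c) p ->
    covd_endo c k (J c) p i = 0
}.

Definition kahler : Prop := exists J, kahler_structure J.

(* phi X = - nabla_X xi *)
Definition sasaki_phi (xi : atlas N -> N -> 'rV[R]_n) (c : atlas N) (p : N)
    : 'M[R]_n :=
  - (\matrix_(k < n) covd c k (xi c) p).

(* xi is a unit Killing field such that, with eta X = g(xi, X),
   phi^2 X = - X + eta(X) xi  and
   (nabla_X phi) Y = g(X, Y) xi - eta(Y) X *)
Record sasakian_structure (xi : atlas N -> N -> 'rV[R]_n) : Prop := {
  sasaki_smooth : forall c j,
    smooth_in (chart_of c) [set: N] (fun p => xi c p 0 j);
  sasaki_change : forall c d p, dom (chart_of c) p -> dom (chart_of d) p ->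
    xi d p = xi c p *m jac c d p;
  sasaki_unit : forall c p, dom (chart_of c) p -> ip (g c p) (xi c p) (xi c p) = 1;
  sasaki_killing : forall c p i j, dom (chart_of c) p ->
    ip (g c p) (covd c i (xi c) p) 'e_j + ip (g c p) 'e_i (covd c j (xi c) p) = 0;
  sasaki_phi_sqr : forall c p (v : 'rV[R]_n), dom (chart_of c) p ->
    v *m sasaki_phi xi c p *m sasaki_phi xi c p =
      - v + ip (g c p) (xi c p) v *: xi c p;
  sasaki_phi_covd : forall c k i p, dom (chart_of c) p ->
    covd_endo c k (sasaki_phi xi c) p i =
      ip (g c p) 'e_k 'e_i *: xi c p - ip (g c p) (xi c p) 'e_i *: 'e_k
}.

Definition sasakian : Prop := exists xi, sasakian_structure xi.

End Structures.

Section Hypersurface.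
Context {R : realType} {m : nat} {N : manifold R m.+1} {g : metric N}.
Variables (D : levi_civita g) (M : manifold R m) (F : M -> N).

(* row i is dF (d_i) *)
Definition dmap (c : atlas M) (d : atlas N) (p : M) : 'M[R]_(m, m.+1) :=
  \matrix_(i, j) pd (chart_of c) i (fun q => crd (chart_of d) (F q) 0 j) p.

(* M, mapped to N by F, is an (immersed) hypersurface *)
Record hypersurface : Prop := {
  hyp_continuous : continuous F;
  hyp_smooth : forall c d j,
    smooth_in (chart_of c) (F @^-1` dom (chart_of d))
      (fun q => crd (chart_of d) (F q) 0 j);
  hyp_immersion : forall (c : atlas M) (d : atlas N) p,
    dom (chart_of c) p -> dom (chart_of d) (F p) -> row_free (dmap c d p)
}.

(* nu d p are the components in the chart d of a vector of T_(F p) N *)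
Record unit_normal (U : set M) (nu : atlas N -> M -> 'rV[R]_m.+1) : Prop := {
  normal_open : open U;
  normal_smooth : forall (c : atlas M) (d : atlas N) j,
    smooth_in (chart_of c) (U `&` F @^-1` dom (chart_of d))
      (fun q => nu d q 0 j);
  normal_change : forall d d' p, U p ->
    dom (chart_of d) (F p) -> dom (chart_of d') (F p) ->
    nu d' p = nu d p *m jac d d' (F p);
  normal_unit : forall d p, U p -> dom (chart_of d) (F p) ->
    ip (g d (F p)) (nu d p) (nu d p) = 1;
  normal_orth : forall (c : atlas M) (d : atlas N) p i, U p ->
    dom (chart_of c) p -> dom (chart_of d) (F p) ->
    ip (g d (F p)) (nu d p) (row i (dmap c d p)) = 0
}.

(* nabla_(d_k) nu for a vector field nu along F *)
Definition covd_along (nu : atlas N -> M -> 'rV[R]_m.+1) (c : atlas M)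
    (d : atlas N) (k : 'I_m) (p : M) : 'rV[R]_m.+1 :=
  \row_j pd (chart_of c) k (fun q => nu d q 0 j) p
  + \sum_(a < m.+1) \sum_(b < m.+1)
      (dmap c d p k a * nu d p 0 b) *: christ D d (F p) a b.

(* II is the endomorphism of TM with dF (II X) = - nabla_X nu on U.  It exists,
   since nabla_X nu is orthogonal to nu, and is unique, since dF is
   injective. *)
Definition weingarten (U : set M) (nu : atlas N -> M -> 'rV[R]_m.+1)
    (II : atlas M -> M -> 'M[R]_m) : Prop :=
  forall (c : atlas M) (d : atlas N) p k, U p ->
    dom (chart_of c) p -> dom (chart_of d) (F p) ->
    row k (II c p) *m dmap c d p = - covd_along nu c d k p.

(* The trace does not depend on the chart c around p. *)
Definition mean_curvature (II : atlas M -> M -> 'M[R]_m) (c : atlas M) (p : M)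
    : R :=
  m%:R^-1 * \tr (II c p).

Definition totally_umbilical : Prop :=
  forall U nu II, unit_normal U nu -> weingarten U nu II ->
  forall c p (X : 'rV[R]_m), U p -> dom (chart_of c) p ->
    X *m II c p = mean_curvature II c p *: X.

(* dH = 0: the partial derivatives of H exist and vanish, for every local
   choice of the unit normal *)
Definition constant_mean_curvature : Prop :=
  forall U nu II, unit_normal U nu -> weingarten U nu II ->
  forall (c : atlas M) p (i : 'I_m), U p -> dom (chart_of c) p ->
    is_derive (crd (chart_of c) p) 'e_i
      (mean_curvature II c \o crdV (chart_of c)) 0.

End Hypersurface.

(* Main.v *)
(** No curvature is needed.  Let A be the complex structure of N, or phi in the
   Sasakian case, B(X, Y) = g(A X, Y), and let eta = g(xi, -), with xi = 0 in the
   Kaehler case; in both cases (nabla_X A) Y = g(X, Y) xi - eta(Y) X, which makes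
   B a closed 2-form.  On an umbilical M with normal nu and mean curvature H,
   nabla_X nu = - H X, and differentiating the 1-form omega = B(nu, -) on M gives
   d omega = - 2 H B.  Hence dH /\ B = 0 on M.  In the Sasakian case
   d (eta(nu)) = omega - H eta on M, and d eta = - 2 B, so dH /\ eta = 0 as well.
   If dH <> 0 at a point, then B and eta vanish on the hyperplane ker dH of TM,
   of dimension m - 1.  But B is nondegenerate on ker eta, and an isotropic
   subspace on which v |-> B(v, -) is injective has dimension at most (m + 1) / 2:
   this is impossible for m >= 4.  The same count shows that B does not vanish on
   TM, so that H is smooth, being a quotient. *)

From HB Require Import structures.
Require Import Defs.
From mathcomp Require Import all_boot all_order all_algebra.
From mathcomp Require Import all_classical all_reals all_analysis.
From mathcomp Require Import ring lra zify.

Set Implicit Arguments.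
Unset Strict Implicit.
Unset Printing Implicit Defensive.

Import Order.TTheory GRing.Theory Num.Theory.
Import numFieldNormedType.Exports.
Local Open Scope classical_set_scope.
Local Open Scope ring_scope.

(** * Differential calculus on open subsets of R^n *)

(** Both sides are limits of the same difference quotient. This carries one-variable calculus over
    to directional derivatives. *)
Lemma is_derive_line (R : realType) (V W : normedModType R) (f : V -> W)
    (x v : V) (t : R) (d : W) :
  is_derive (x + t *: v) v f d <->
  is_derive t 1 (fun s : R => f (x + s *: v)) d.
Proof.
pose q h : W := h^-1 *: ((f \o shift (x + t *: v)) (h *: v) - f (x + t *: v)).
have E : (fun h : R => h^-1 *: (((fun s : R => f (x + s *: v)) \o shift t) (h *: (1 : R))
  - f (x + t *: v))) = q.
  apply/funext => h; rewrite /q /=; congr (_ *: (f _ - _)).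
  by rewrite [h *: 1]mulr1 scalerDl addrCA.
by split => -[d1 d2]; split; move: d1 d2; rewrite /derivable /derive E.
Qed.

(** The one-variable mean value theorem on the segment between 0 and [s]. The bound by absolute
    values covers both signs of [s], which are treated separately because the segment has to be
    ordered. *)
Lemma line_MVT (R : realType) (V : normedModType R) (f : V -> R) (x v : V) (s : R) :
  (forall t, `|t| <= `|s| -> derivable f (x + t *: v) v) ->
  exists2 t, `|t| <= `|s| & f (x + s *: v) - f x = s * 'D_v f (x + t *: v).
Proof.
move=> df; pose g t : R := f (x + t *: v); pose dg t : R := 'D_v f (x + t *: v).
have gd (t : R) : `|t| <= `|s| -> is_derive t 1 g (dg t).
  by move=> ts; exact: (iffLR (is_derive_line f x v t _) (derivableP (df t ts))).
have g0 : g 0 = f x by rewrite /g scale0r addr0.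
have [s0|s0] := lerP 0 s.
  have sub (t : R) : t \in `[0, s] -> `|t| <= `|s|.
    by rewrite in_itv /= => /andP[t0 ts]; rewrite !ger0_norm.
  have [||t ts] := @MVT_segment R g dg 0 s s0.
  - by move=> t ts; apply/gd/sub/subset_itv_oo_cc.
  - by apply: derivable_within_continuous => t /sub/gd[].
  by rewrite g0 subr0 => E; exists t; [exact: sub|rewrite mulrC -E].
have sub (t : R) : t \in `[s, 0] -> `|t| <= `|s|.
  by rewrite in_itv /= => /andP[t0 ts]; rewrite (ler0_norm ts) (ltr0_norm s0) lerN2.
have [||t ts] := @MVT_segment R g dg s 0 (ltW s0).
- by move=> t ts; apply/gd/sub/subset_itv_oo_cc.
- by apply: derivable_within_continuous => t /sub/gd[].
rewrite g0 sub0r => E; exists t; first exact: sub.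
by apply: oppr_inj; rewrite opprB E mulrN mulrC.
Qed.

(** The remainder bound is a little-o expansion, and a continuous linear map with such an expansion
    has to be the differential. *)
Lemma differential_unique (R : realType) (V W : normedModType R) (f : V -> W)
  (df : {linear V -> W}) (x : V) : continuous df ->
  (forall e : R, 0 < e -> exists2 r : R, 0 < r &
    forall h, `|h| < r -> `|f (x + h) - f x - df h| <= e * `|h|) ->
  differentiable f x /\ 'd f x = df :> (V -> W).
Proof.
move=> dfc H.
have dfo : f \o shift x = cst (f x) + df +o_ 0 id.
  apply/eqaddoP => e e0; have [r r0 He] := H e e0.
  near=> h.
  have hr : `|h| < r by near: h; exact: nbhs0_lt.
  rewrite -![(_ + _ : _ -> _) _]/(_ + _) -![(- _ : _ -> _) _]/(- _) /=.
  by rewrite opprD addrA [h + x]addrC; exact: He.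
have dE : 'd f x = df :> (V -> W) by exact: diff_unique.
by split => //; apply/diff_locallyP; rewrite dE.
Unshelve. all: by end_near. Qed.

(** * Functions with continuous partial derivatives *)

Section Partial.
Context {R : realType} {n : nat}.
Implicit Types (x y h : 'rV[R]_n) (f : 'rV[R]_n -> R).

Lemma coord_le_norm x i : `|x 0 i| <= `|x|.
Proof.
rewrite [leRHS]/Num.Def.normr /= mx_normrE.
exact: (@le_bigmax _ _ _ _ (fun k : 'I_1 * 'I_n => `|x k.1 k.2|) (0, i)).
Qed.

Lemma norm_le_coord x (e : R) : 0 <= e -> (forall i, `|x 0 i| <= e) -> `|x| <= e.
Proof.
move=> e0 xe; rewrite [leLHS]/Num.Def.normr /= mx_normrE.
by apply: bigmax_le => // -[i j] _ /=; rewrite ord1.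
Qed.

Lemma norm_ebase_le (t : R) (i : 'I_n) : `|t *: ('e_i : 'rV[R]_n)| <= `|t|.
Proof.
apply: norm_le_coord => // j; rewrite !mxE normrM ler_piMr //.
by case: (_ && _); rewrite ?normr1 ?normr0.
Qed.

(** Walk from [x] to [x + h] one coordinate at a time and apply [line_MVT] on each leg. In the sup
    norm no point of the path is farther from [x] than [h] allows. *)
Lemma partial_increment f x (r e : R) h : 0 <= e -> `|h| < r ->
  (forall y i, `|y - x| < r -> derivable f y 'e_i) ->
  (forall y i, `|y - x| < r -> `|'D_('e_i) f y - 'D_('e_i) f x| <= e) ->
  `|f (x + h) - f x - \sum_i h 0 i * 'D_('e_i) f x| <= n%:R * e * `|h|.
Proof.
move=> e0 hr df De.
(* [P k] keeps the first [k] coordinates of [h], so it runs from 0 to [h]. *)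
pose P k : 'rV[R]_n := \row_i (if (i < k)%N then h 0 i else 0).
have PS (k : 'I_n) : P k.+1 = P k + h 0 k *: 'e_k.
  apply/rowP => i; rewrite !mxE eqxx /= ltnS leq_eqVlt val_eqE.
  case: (eqVneq i k) => [->|ik]; first by rewrite ltnn mulr1 add0r.
  by rewrite mulr0 addr0.
have -> : f (x + h) - f x = \sum_(k < n) (f (x + P k.+1) - f (x + P k)).
  rewrite -(big_mkord xpredT (fun k => f (x + P k.+1) - f (x + P k))).
  rewrite telescope_sumr //; congr (f _ - f _).
    by congr (_ + _); apply/rowP => i; rewrite !mxE ltn_ord.
  by rewrite -[LHS]addr0; congr (_ + _); apply/rowP => i; rewrite !mxE ltn0.
rewrite -sumrB.
have -> : n%:R * e * `|h| = \sum_(k < n) (e * `|h|).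
  by rewrite sumr_const card_ord -[RHS]mulr_natl mulrA.
apply: le_trans (ler_norm_sum _ _ _) _; apply: ler_sum => k _.
have bnd t : `|t| <= `|h 0 k| -> `|(x + P k + t *: 'e_k) - x| < r.
  move=> th; apply: le_lt_trans hr; rewrite -[x + P k + _]addrA addrAC subrr add0r.
  apply: norm_le_coord => // i; rewrite !mxE /=.
  case: (eqVneq i k) => [->|ik].
    by rewrite ltnn mulr1 add0r (le_trans th) // coord_le_norm.
  by rewrite mulr0 addr0; case: ifP => _; rewrite ?normr0 ?coord_le_norm.
have [t th E] := line_MVT (f := f) (x := x + P k) (v := 'e_k) (s := h 0 k)
  (fun t th => df _ _ (bnd t th)).
rewrite PS addrA E -mulrBr normrM mulrC ler_pM //; first exact/De/bnd.
exact: coord_le_norm.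
Qed.

Lemma C1_near (U : set 'rV[R]_n) f x (e : R) :
  open U -> Ck_on 1 U f -> U x -> 0 < e ->
  exists2 r, 0 < r & forall y, `|y - x| < r ->
    U y /\ forall i, `|'D_('e_i) f y - 'D_('e_i) f x| <= e.
Proof.
move=> Uo [_ Cf] Ux e0.
have : \forall y \near x,
    U y /\ forall i, `|'D_('e_i) f y - 'D_('e_i) f x| <= e.
  have De : \forall y \near x, forall i, `|'D_('e_i) f y - 'D_('e_i) f x| <= e.
    suff Di i : \forall y \near x, `|'D_('e_i) f y - 'D_('e_i) f x| <= e.
      exact: (filter_forall _ Di).
    have [_ [/(_ _ Ux) cD _]] := Cf i.
    by move/cvgrPdistC_le: cD => /(_ _ e0).
  have nU : nbhs x U by exact: open_nbhs_nbhs.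
  by near do split.
move=> /nbhs_ballP[r /= r0 rU]; exists r => // y yr.
by apply: rU; rewrite -ball_normE /= distrC.
Unshelve. all: by end_near. Qed.

(** Continuity of the partial derivatives makes the error in [partial_increment] small relative to
    [h]. *)
Lemma C1_is_diff (U : set 'rV[R]_n) f x : open U -> Ck_on 1 U f -> U x ->
  differentiable f x /\
  forall h, 'd f x h = \sum_i h 0 i * 'D_('e_i) f x.
Proof.
move=> Uo Cf Ux; pose df (h : 'rV[R]_n) : R := \sum_i h 0 i * 'D_('e_i) f x.
have lin : linear df.
  move=> a u v; rewrite /df scaler_sumr -big_split /=.
  by apply: eq_bigr => i _; rewrite !mxE mulrDl scalerAl.
pose dfl : {linear 'rV[R]_n -> R} :=
  HB.pack df (GRing.isLinear.Build R _ _ _ df lin).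
have dfc : continuous dfl.
  have -> : (dfl : _ -> _) = \sum_i (fun h : 'rV[R]_n => h 0 i * 'D_('e_i) f x).
    by apply/funext => h; rewrite fct_sumE.
  apply: (big_ind (fun g : 'rV[R]_n -> R => continuous g)) => [|g1 g2 c1 c2 h|i _ h].
  - exact: cst_continuous.
  - exact: continuousD (c1 h) (c2 h).
  - have dm : differentiable (fun y : 'rV[R]_n => y 0 i * 'D_('e_i) f x) h.
      by apply: differentiableM; [exact: differentiable_coord|exact: differentiable_cst].
    exact: differentiable_continuous dm.
suff H : forall e : R, 0 < e -> exists2 r : R, 0 < r &
    forall h, `|h| < r -> `|f (x + h) - f x - dfl h| <= e * `|h|.
  have [dfx dE] := @differential_unique _ _ _ f dfl x dfc H.
  by split => // h; rewrite dE.
(* The division absorbs the factor [n] of [partial_increment]; [n.+1] avoids a zero denominator. *)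
move=> e e0; have e'0 : 0 < e / n.+1%:R by rewrite divr_gt0.
have [r r0 rU] := C1_near Uo Cf Ux e'0; exists r => // h hr.
apply: le_trans (partial_increment (ltW e'0) hr _ _) _; last first.
- rewrite ler_wpM2r // mulrCA ler_piMr ?(ltW e0) // ler_pdivrMr // mul1r.
  by rewrite ler_nat.
- by move=> y i /rU[_].
- by move=> y i /rU[Uy _]; have [_ /(_ i)[/(_ _ Uy)]] := Cf.
Qed.

(** The map [F] need only be derivable at [x] in the direction [v]: it is restricted to the line
    through [x], and the resulting curve is composed with the differentiable [f]. *)
Lemma C1_chain (m : nat) (U : set 'rV[R]_n) f (F : 'rV[R]_m -> 'rV[R]_n)
    (x v : 'rV[R]_m) :
  open U -> Ck_on 1 U f -> U (F x) ->
  (forall a, derivable (fun z => F z 0 a) x v) ->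
  is_derive x v (f \o F)
    (\sum_a 'D_v (fun z => F z 0 a) x * 'D_('e_a) f (F x)).
Proof.
move=> Uo Cf UFx dF.
have [df dE] := C1_is_diff Uo Cf UFx.
have dFx : derivable F x v by apply/derivable_mxP => i a; rewrite ord1.
pose g (t : R) := F (x + t *: v).
have Fg : is_derive (0 : R) 1 g ('D_v F x).
  by apply: (iffLR (is_derive_line F x v 0 _)); rewrite scale0r addr0; exact: derivableP.
have g0 : g 0 = F x by rewrite /g scale0r addr0.
have dg : differentiable g 0 by apply/derivable1_diffP; case: Fg.
have dfg : differentiable f (g 0) by rewrite g0.
suff : is_derive (0 : R) 1 (f \o g)
    (\sum_a 'D_v (fun z => F z 0 a) x * 'D_('e_a) f (F x)).
  by move/(iffRL (is_derive_line (f \o F) x v 0 _)); rewrite scale0r addr0.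
split; first exact/diff_derivable/differentiable_comp.
rewrite deriveE; last exact: differentiable_comp.
have -> : 'd (f \o g) 0 1 = 'd f (g 0) ('d g 0 1) by rewrite diff_comp.
have -> : 'd g 0 1 = 'D_v F x by case: Fg => _ <-; rewrite deriveE.
rewrite g0 dE (derive_mx dFx).
by apply: eq_bigr => a _; rewrite mxE.
Qed.

End Partial.

Lemma near_eq_continuous (T U : topologicalType) (f g : T -> U) (x : T) :
  (\forall y \near x, f y = g y) ->
  {for x, continuous f} -> {for x, continuous g}.
Proof.
move=> fg cf; rewrite /prop_for /continuous_at -(nbhs_singleton fg).
apply: cvg_trans cf; apply: near_eq_cvg.
by apply: filterS fg => y ->.
Qed.

Section PointwiseDerive.
Context {R : realType} {V : normedModType R}.
Implicit Types (f g : V -> R) (x v : V) (a b : R).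

Lemma is_derive_add f g x v a b : is_derive x v f a -> is_derive x v g b ->
  is_derive x v (fun y => f y + g y) (a + b).
Proof. exact: is_deriveD. Qed.

Lemma is_derive_mul f g x v a b : is_derive x v f a -> is_derive x v g b ->
  is_derive x v (fun y => f y * g y) (a * g x + f x * b).
Proof. by move=> df dg; rewrite addrC [a * _]mulrC; exact: is_deriveM. Qed.

Lemma is_derive_bigsum n (f : 'I_n -> V -> R) x v (a : 'I_n -> R) :
  (forall i, is_derive x v (f i) (a i)) ->
  is_derive x v (fun y => \sum_i f i y) (\sum_i a i).
Proof.
move=> df; have -> : (fun y => \sum_i f i y) = \sum_i f i.
  by apply/funext => y; rewrite fct_sumE.
exact: is_derive_sum.
Qed.

End PointwiseDerive.

(** * Closure properties of C^k functions *)

Section Ck.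
Context {R : realType} {n : nat}.
Implicit Types (U : set 'rV[R]_n) (f g : 'rV[R]_n -> R).

Lemma Ck_continuous k U f x : Ck_on k U f -> U x -> {for x, continuous f}.
Proof. by case: k => [|k] [+ _] => /(_ x). Qed.

Lemma Ck_derivable k U f i x : Ck_on k.+1 U f -> U x -> derivable f x 'e_i.
Proof. by case=> _ /(_ i)[+ _] => /(_ x). Qed.

Lemma Ck_derive k U f i : Ck_on k.+1 U f -> Ck_on k U ('D_('e_i) f).
Proof. by case=> _ /(_ i)[]. Qed.

Lemma Ck_pred k U f : Ck_on k.+1 U f -> Ck_on k U f.
Proof.
elim: k f => [|k IH] f [cf df]; split=> // i.
by have [dfi Di] := df i; split=> //; exact: IH.
Qed.

Lemma Ck_le k l U f : (k <= l)%N -> Ck_on l U f -> Ck_on k U f.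
Proof.
move=> /subnKC <-; elim: (l - k)%N => [|j IH]; rewrite ?addn0 // addnS.
by move=> /Ck_pred.
Qed.

Lemma Ck_sub k U U' f : U' `<=` U -> Ck_on k U f -> Ck_on k U' f.
Proof.
move=> U'U; elim: k f => [|k IH] f [cf df]; split=> //.
- by move=> x /U'U/cf.
- by move=> x /U'U/cf.
by move=> i; have [dfi Di] := df i; split=> [x /U'U/dfi //|]; exact: IH.
Qed.

(** On an open set, equality on [U] is equality near each point, so it passes to derivatives. In the
    inductions below it replaces a derivative by the formula that computes it. *)
Lemma Ck_ext k U f g : open U -> (forall x, U x -> f x = g x) ->
  Ck_on k U f -> Ck_on k U g.
Proof.
move=> Uo.
have near_fg h1 h2 x : (forall y, U y -> h1 y = h2 y) -> U x ->
    \forall y \near x, h1 y = h2 y :> R.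
  by move=> h12 Ux; near do apply: h12; exact: open_nbhs_nbhs.
elim: k f g => [|k IH] f g fg [cf df]; split=> //.
- by move=> x Ux; exact: near_eq_continuous (near_fg _ _ _ fg Ux) (cf x Ux).
- by move=> x Ux; exact: near_eq_continuous (near_fg _ _ _ fg Ux) (cf x Ux).
move=> i; have [dfi Di] := df i; split=> [x Ux|].
  exact: near_eq_derivable (near_fg _ _ _ fg Ux) (dfi x Ux).
apply: IH Di => x Ux; exact: near_eq_derive (near_fg _ _ _ fg Ux).
Unshelve. all: by end_near. Qed.

Lemma Ck_add k U f g : open U -> Ck_on k U f -> Ck_on k U g ->
  Ck_on k U (fun x => f x + g x).
Proof.
move=> Uo; elim: k f g => [|k IH] f g Cf Cg.
  split=> // x Ux.
  by apply: continuousD; [exact: Ck_continuous Cf Ux|exact: Ck_continuous Cg Ux].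
split=> [x Ux|i].
  by apply: continuousD; [exact: Ck_continuous Cf Ux|exact: Ck_continuous Cg Ux].
have D x : U x -> is_derive x 'e_i (fun x => f x + g x) _ := fun Ux =>
  is_derive_add (derivableP (Ck_derivable (i:=i) Cf Ux))
    (derivableP (Ck_derivable (i:=i) Cg Ux)).
split=> [x /D[]//|].
apply: (Ck_ext Uo _ (IH _ _ (Ck_derive i Cf) (Ck_derive i Cg))).
by move=> x /D[].
Qed.

Lemma Ck_mul k U f g : open U -> Ck_on k U f -> Ck_on k U g ->
  Ck_on k U (fun x => f x * g x).
Proof.
move=> Uo; elim: k f g => [|k IH] f g Cf Cg.
  split=> // x Ux.
  by apply: continuousM; [exact: Ck_continuous Cf Ux|exact: Ck_continuous Cg Ux].
split=> [x Ux|i].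
  by apply: continuousM; [exact: Ck_continuous Cf Ux|exact: Ck_continuous Cg Ux].
have D x : U x -> is_derive x 'e_i (fun x => f x * g x) _ := fun Ux =>
  is_derive_mul (derivableP (Ck_derivable (i:=i) Cf Ux))
    (derivableP (Ck_derivable (i:=i) Cg Ux)).
split=> [x /D[]//|].
apply: (Ck_ext Uo _ (Ck_add Uo (IH _ _ (Ck_derive i Cf) (Ck_pred Cg))
  (IH _ _ (Ck_pred Cf) (Ck_derive i Cg)))).
by move=> x /D[].
Qed.

Lemma Ck_cst k U (c : R) : Ck_on k U (fun=> c).
Proof.
elim: k c => [|k IH] c; split=> //; try by move=> x _; exact: cst_continuous.
move=> i; split=> [x _|]; first exact: derivable_cst.
suff -> : 'D_('e_i) (fun=> c : R) = fun=> 0 by [].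
by move=> x; apply/funext => y; rewrite derive_cst.
Qed.

Lemma Ck_sum k U m (f : 'I_m -> 'rV[R]_n -> R) : open U ->
  (forall i, Ck_on k U (f i)) -> Ck_on k U (fun x => \sum_i f i x).
Proof.
move=> Uo Cf; have -> : (fun y => \sum_i f i y) = \sum_i f i.
  by apply/funext => y; rewrite fct_sumE.
by apply: big_ind => // [|g h]; [exact: Ck_cst|exact: Ck_add].
Qed.

End Ck.

Lemma continuous_rV (R : realType) (n : nat) (T : topologicalType)
    (F : T -> 'rV[R]_n) (x : T) :
  (forall i, {for x, continuous (fun y => F y 0 i)}) -> {for x, continuous F}.
Proof.
move=> cF; apply/cvgrPdist_le => e e0.
suff Fi i : \forall y \near x, `|F x 0 i - F y 0 i| <= e.
  apply: filterS (filter_forall _ Fi) => y Fy.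
  by apply: norm_le_coord (ltW e0) _ => i; rewrite !mxE.
by move/cvgrPdist_le: (cF i) => /(_ _ e0).
Qed.

(** Induction on [k]: by [C1_chain] the derivatives of the composite are sums of products of
    functions that are C^k by the induction hypothesis. *)
Lemma Ck_comp (R : realType) (m n k : nat) (V : set 'rV[R]_m)
    (W : set 'rV[R]_n) (f : 'rV[R]_n -> R) (F : 'rV[R]_m -> 'rV[R]_n) :
  open V -> open W -> (forall x, V x -> W (F x)) -> Ck_on k W f ->
  (forall a, Ck_on k V (fun x => F x 0 a)) -> Ck_on k V (f \o F).
Proof.
move=> Vo Wo VW; elim: k f => [|k IH] f Cf CF.
all: have cfF x : V x -> {for x, continuous (f \o F)}.
1,3: move=> Vx; apply: continuous_comp; last exact: Ck_continuous Cf (VW _ Vx).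
1,2: by apply: continuous_rV => a; exact: Ck_continuous (CF a) Vx.
- by [].
split=> // i.
have D x (Vx : V x) := C1_chain Wo (Ck_le (isT : 1 <= k.+1)%N Cf) (VW _ Vx)
  (fun a => Ck_derivable (i:=i) (CF a) Vx).
split=> [x /D[]//|].
apply: (Ck_ext Vo _ (Ck_sum Vo (fun a => Ck_mul Vo (Ck_derive i (CF a))
  (IH _ (Ck_derive a Cf) (fun b => Ck_pred (CF b)))))).
by move=> x /D[].
Qed.

Lemma is_derive_translate (R : realType) (V W : normedModType R) (f : V -> W)
    (x v w : V) (d : W) :
  is_derive (x + w) v f d -> is_derive x v (fun y => f (y + w)) d.
Proof.
pose q h : W := h^-1 *: ((f \o shift (x + w)) (h *: v) - f (x + w)).
have E : (fun h : R => h^-1 *: (((fun y => f (y + w)) \o shift x) (h *: v)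
    - f (x + w))) = q.
  by apply/funext => h; rewrite /q /= addrA.
by case=> d1 d2; split; move: d1 d2; rewrite /derivable /derive E.
Qed.

(** * Symmetry of second derivatives *)

Section Schwarz.
Context {R : realType} {n : nat}.
Implicit Types (U : set 'rV[R]_n) (f : 'rV[R]_n -> R) (x : 'rV[R]_n).

(** The mean value theorem is used twice, along ['e_i] and then along ['e_j]. The second difference
    itself is symmetric in [i] and [j], which is what [derive_sym] exploits. *)
Lemma second_difference U f i j x (r s : R) :
  (forall y, `|y - x| < r -> U y) -> Ck_on 2 U f -> `|s| + `|s| < r ->
  exists2 z, `|z - x| < r &
    f (x + s *: 'e_i + s *: 'e_j) - f (x + s *: 'e_i) - f (x + s *: 'e_j) + f x
    = s * (s * 'D_('e_j) ('D_('e_i) f) z).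
Proof.
move=> rU Cf sr.
have near1 t t' : `|t| <= `|s| -> `|t'| <= `|s| ->
    `|(x + t *: 'e_i + t' *: 'e_j) - x| < r.
  move=> ts t's; apply: le_lt_trans sr.
  rewrite -[x + _ + _]addrA addrAC subrr add0r.
  apply: le_trans (ler_normD _ _) _; apply: lerD.
    exact: le_trans (norm_ebase_le _ _) ts.
  exact: le_trans (norm_ebase_le _ _) t's.
have near0 t : `|t| <= `|s| -> `|(x + t *: 'e_i) - x| < r.
  by move=> /(near1 t 0); rewrite scale0r addr0 normr0 normr_ge0; apply.
(* The second difference is the increment of [h] along ['e_i]. *)
pose h y := f (y + s *: 'e_j) - f y.
have hd t : `|t| <= `|s| -> is_derive (x + t *: 'e_i) 'e_i h
    ('D_('e_i) f (x + t *: 'e_i + s *: 'e_j) - 'D_('e_i) f (x + t *: 'e_i)).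
  move=> ts; apply: is_deriveB; last first.
    by apply/derivableP/(Ck_derivable Cf)/rU/near0.
  apply: is_derive_translate.
  by apply/derivableP/(Ck_derivable Cf)/rU/near1.
have [t ts Et] : exists2 t, `|t| <= `|s| & h (x + s *: 'e_i) - h x =
    s * 'D_('e_i) h (x + t *: 'e_i).
  by apply: line_MVT => t /hd[].
have [t' t's Et'] : exists2 t', `|t'| <= `|s| &
    'D_('e_i) f (x + t *: 'e_i + s *: 'e_j) - 'D_('e_i) f (x + t *: 'e_i) =
    s * 'D_('e_j) ('D_('e_i) f) (x + t *: 'e_i + t' *: 'e_j).
  apply: (line_MVT (f := 'D_('e_i) f) (x := x + t *: 'e_i)) => t' t's.
  by apply: (Ck_derivable (Ck_derive i Cf)); exact/rU/near1.
exists (x + t *: 'e_i + t' *: 'e_j); first exact: near1.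
have [_ hE] := hd t ts.
by rewrite -Et' -hE -Et /h opprB addrA addrAC.
Qed.

Let common_value_dist (s a b a1 b1 a0 b0 e : R) : 0 < s ->
  a = s * (s * a1) -> b = s * (s * b1) -> a = b ->
  `|a1 - a0| <= e / 2 -> `|b1 - b0| <= e / 2 -> `|b0 - a0| <= e.
Proof.
move=> s0 -> -> E Ha Hb; have sn0 : s != 0 by rewrite gt_eqF.
move/(mulfI sn0)/(mulfI sn0): E => E; rewrite E in Ha.
rewrite (splitr e); apply: le_trans (ler_distD b1 _ _) (lerD _ _) => //.
by rewrite distrC.
Qed.

(** Divided by the square of [s], the second difference is a value of either mixed derivative at
    some point near [x]; by continuity both are within [e / 2] of their values at [x]. *)
Lemma derive_sym U f i j x : open U -> Ck_on 2 U f -> U x ->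
  'D_('e_i) ('D_('e_j) f) x = 'D_('e_j) ('D_('e_i) f) x.
Proof.
move=> Uo Cf Ux; apply/eqP; rewrite -subr_eq0 -normr_le0.
apply/ler_addgt0Pl => e e0; rewrite addr0.
have e20 : 0 < e / 2 by rewrite divr_gt0.
have [r1 r10 H1] := C1_near Uo (Ck_derive i Cf) Ux e20.
have [r2 r20 H2] := C1_near Uo (Ck_derive j Cf) Ux e20.
pose r := Num.min r1 r2; have r0 : 0 < r by rewrite lt_min r10.
have rr1 : r <= r1 by rewrite ge_min lexx.
have rr2 : r <= r2 by rewrite ge_min lexx orbT.
have rU y : `|y - x| < r -> U y by move=> yr; case: (H1 y (lt_le_trans yr rr1)).
(* Any positive [s] with [s + s < r] would do. *)
pose s := r / 4; have s0 : 0 < s by rewrite divr_gt0.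
have sr : `|s| + `|s| < r by rewrite gtr0_norm // /s; lra.
have [z1 z1r E1] := second_difference i j rU Cf sr.
have [z2 z2r E2] := second_difference j i rU Cf sr.
have [_ /(_ j) {}H1] := H1 z1 (lt_le_trans z1r rr1).
have [_ /(_ i) {}H2] := H2 z2 (lt_le_trans z2r rr2).
apply: (common_value_dist s0 E1 E2 _ H1 H2).
by rewrite [x + _ + _]addrAC; ring.
Qed.

End Schwarz.

(** * Bilinear forms *)

(** Injectivity gives rank [r] to both [S *m B] and the transpose of [S]; two matrices with zero
    product have ranks adding up to at most the inner dimension [n]. *)
Lemma isotropic_rank (K : fieldType) (r n : nat) (S : 'M[K]_(r, n))
    (B : 'M[K]_n) :
  (forall u : 'rV_r, u *m S *m B = 0 -> u = 0) -> S *m B *m S^T = 0 ->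
  (r + r <= n)%N.
Proof.
move=> Binj SBS.
have free_inj (A : 'M[K]_(r, n)) : (forall u : 'rV_r, u *m A = 0 -> u = 0) ->
    \rank A = r.
  by move=> Ai; apply/eqP; exact: inj_row_free.
have rSB : \rank (S *m B) = r by apply: free_inj => u; rewrite mulmxA; exact: Binj.
have rS : \rank S^T = r.
  rewrite mxrank_tr; apply: free_inj => u uS; apply: Binj.
  by rewrite uS mul0mx.
by have := mulmx0_rank_max SBS; rewrite rSB rS.
Qed.

Section BilinearForms.
Context {R : realType} {n : nat}.
Implicit Types (M : 'M[R]_n) (u v w : 'rV[R]_n).

(** Serves to pair a vector with the components of a covector, independently of the metric. *)
Definition dot u v : R := ip 1%:M u v.

Lemma ipE M v w : ip M v w = \sum_i \sum_j v 0 i * w 0 j * M i j.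
Proof.
rewrite /ip !mxE exchange_big /=; apply: eq_bigr => j _.
rewrite !mxE mulr_suml; apply: eq_bigr => i _; ring.
Qed.

Lemma ip_trmx M v w : ip M^T v w = ip M w v.
Proof.
rewrite !ipE exchange_big /=; apply: eq_bigr => i _; apply: eq_bigr => j _.
by rewrite mxE [v 0 _ * _]mulrC.
Qed.

Lemma ip_sym M v w : M^T = M -> ip M v w = ip M w v.
Proof. by move=> ME; rewrite -{1}ME ip_trmx. Qed.

Lemma ip_skew M v w : M^T = - M -> ip M v w = - ip M w v.
Proof. by move=> ME; rewrite -[LHS]ip_trmx ME /ip mulmxN mulNmx mxE. Qed.

Lemma ip_ebase M i j : ip M 'e_i 'e_j = M i j.
Proof. by rewrite /ip -rowE trmx_delta -colE !mxE. Qed.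

Lemma ipDl M u v w : ip M (u + v) w = ip M u w + ip M v w.
Proof. by rewrite /ip !mulmxDl mxE. Qed.

Lemma ipDr M u v w : ip M u (v + w) = ip M u v + ip M u w.
Proof. by rewrite /ip linearD mulmxDr mxE. Qed.

Lemma ipZl M a v w : ip M (a *: v) w = a * ip M v w.
Proof. by rewrite /ip -!scalemxAl mxE. Qed.

Lemma ipZr M a v w : ip M v (a *: w) = a * ip M v w.
Proof. by rewrite /ip linearZ -scalemxAr mxE. Qed.

Lemma ip0l M w : ip M 0 w = 0.
Proof. by rewrite /ip !mul0mx mxE. Qed.

Lemma ip0r M w : ip M w 0 = 0.
Proof. by rewrite /ip trmx0 mulmx0 mxE. Qed.

Lemma ip_suml M m (v : 'I_m -> 'rV[R]_n) w :
  ip M (\sum_i v i) w = \sum_i ip M (v i) w.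
Proof. exact: (big_morph _ (fun u v => ipDl M u v w) (ip0l M w)). Qed.

Lemma ip_sumr M m (v : 'I_m -> 'rV[R]_n) w :
  ip M w (\sum_i v i) = \sum_i ip M w (v i).
Proof. exact: (big_morph _ (ipDr M w) (ip0r M w)). Qed.

Lemma row_ebase v : v = \sum_i v 0 i *: 'e_i.
Proof. exact: row_sum_delta. Qed.

Lemma ip_row M v w : ip M v w = \sum_i v 0 i * ip M 'e_i w.
Proof.
by rewrite {1}[v]row_ebase ip_suml; apply: eq_bigr => i _; rewrite ipZl.
Qed.

Lemma ip_col M v w : ip M v w = \sum_i w 0 i * ip M v 'e_i.
Proof.
by rewrite {1}[w]row_ebase ip_sumr; apply: eq_bigr => i _; rewrite ipZr.
Qed.

Lemma dotC v w : dot v w = dot w v.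
Proof. by rewrite /dot -ip_trmx trmx1. Qed.

Lemma dot_ebase i w : dot 'e_i w = w 0 i.
Proof. by rewrite /dot /ip mulmx1 -rowE !mxE. Qed.

Lemma dotE v w : dot v w = \sum_i v 0 i * w 0 i.
Proof. by rewrite /dot ip_row; apply: eq_bigr => i _; rewrite -(dot_ebase i w). Qed.

Lemma mulmx_trmxE r M (X Y : 'M[R]_(r, n)) i j :
  (X *m M *m Y^T) i j = ip M (row i X) (row j Y).
Proof.
rewrite /ip tr_row -row_mul [LHS]mxE [RHS]mxE; apply: eq_bigr => k _.
by rewrite [row _ _ _ _]mxE [col _ _ _ _]mxE.
Qed.

(** The product rule for an expression trilinear in the matrix and the two vectors, all three of
    which vary. *)
Lemma is_derive_ip (V : normedModType R) (M : V -> 'M[R]_n) (Y Z : V -> 'rV[R]_n)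
    (x v : V) (dM : 'M[R]_n) (dY dZ : 'rV[R]_n) :
  (forall i j, is_derive x v (fun y => M y i j) (dM i j)) ->
  (forall i, is_derive x v (fun y => Y y 0 i) (dY 0 i)) ->
  (forall i, is_derive x v (fun y => Z y 0 i) (dZ 0 i)) ->
  is_derive x v (fun y => ip (M y) (Y y) (Z y))
    (ip (M x) dY (Z x) + ip (M x) (Y x) dZ + ip dM (Y x) (Z x)).
Proof.
move=> HM HY HZ.
under eq_fun do rewrite ipE.
have D i j : is_derive x v (fun y => Y y 0 i * Z y 0 j * M y i j)
    ((dY 0 i * Z x 0 j + Y x 0 i * dZ 0 j) * M x i j + Y x 0 i * Z x 0 j * dM i j).
  exact: is_derive_mul (is_derive_mul (HY i) (HZ j)) (HM i j).
apply: is_derive_eq.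
  by apply: is_derive_bigsum => i; apply: is_derive_bigsum => j; exact: D.
rewrite !ipE -!big_split /=; apply: eq_bigr => i _.
by rewrite -!big_split /=; apply: eq_bigr => j _; ring.
Qed.

Lemma Ck_ip k m (U : set 'rV[R]_m) (M : 'rV[R]_m -> 'M[R]_n)
    (Y Z : 'rV[R]_m -> 'rV[R]_n) : open U ->
  (forall i j, Ck_on k U (fun y => M y i j)) ->
  (forall i, Ck_on k U (fun y => Y y 0 i)) ->
  (forall i, Ck_on k U (fun y => Z y 0 i)) ->
  Ck_on k U (fun y => ip (M y) (Y y) (Z y)).
Proof.
move=> Uo CM CY CZ; under eq_fun do rewrite ipE.
apply: Ck_sum => // i; apply: Ck_sum => // j; apply: Ck_mul => //.
exact: Ck_mul.
Qed.

End BilinearForms.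

(** * Covectors whose wedge product with a form vanishes *)

Section WedgeKernel.
Context {R : realType} {m : nat} (a : 'I_m -> R) (i : 'I_m).
Hypothesis ai0 : a i != 0.

(** The hypothesis is the vanishing of the components of a /\ e that involve [i]. As [a i] is
    nonzero, [e] is a multiple of [a]. *)
Lemma wedge1_kernel (e : 'I_m -> R) (u : 'rV[R]_m) :
  (forall k, a i * e k = a k * e i) -> \sum_k u 0 k * a k = 0 ->
  \sum_k u 0 k * e k = 0.
Proof.
move=> ae u0; apply: (mulfI ai0); rewrite mulr0 mulr_sumr.
transitivity ((\sum_k u 0 k * a k) * e i); last by rewrite u0 mul0r.
by rewrite mulr_suml; apply: eq_bigr => k _; rewrite mulrCA ae mulrA.
Qed.

(** The hypothesis says that a /\ O vanishes as soon as one argument is ['e_i]. Inserting [u] and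
    [v] from the kernel of [a] in the other two places leaves only [a i] times O(u, v). *)
Lemma wedge2_kernel (O : 'I_m -> 'I_m -> R) (u v : 'rV[R]_m) :
  (forall j k, a k * O j i + a j * O i k + a i * O k j = 0) ->
  \sum_k u 0 k * a k = 0 -> \sum_j v 0 j * a j = 0 ->
  \sum_k u 0 k * (\sum_j v 0 j * O k j) = 0.
Proof.
move=> aO u0 v0; apply: (mulfI ai0); rewrite mulr0 mulr_sumr.
transitivity (- ((\sum_k u 0 k * a k) * (\sum_j v 0 j * O j i)
    + (\sum_k u 0 k * O i k) * (\sum_j v 0 j * a j))); last first.
  by rewrite u0 v0 mul0r mulr0 addr0 oppr0.
rewrite !big_distrlr -big_split /= -sumrN; apply: eq_bigr => k _.
rewrite -big_split /= -sumrN !mulr_sumr; apply: eq_bigr => j _.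
have -> : a i * (u 0 k * (v 0 j * O k j)) = u 0 k * v 0 j * (a i * O k j) by ring.
have -> : a i * O k j = - (a k * O j i + a j * O i k).
  by apply/eqP; rewrite -addr_eq0 addrC aO.
ring.
Qed.

End WedgeKernel.

Section CovectorKernel.
Context {R : realType} {m : nat} (S : 'M[R]_(m, m.+1)) (B : 'M[R]_m.+1).
Context (eta : 'rV[R]_m.+1) (a : 'I_m -> R).
Hypothesis S_free : row_free S.
Hypothesis nondeg : forall w, dot w eta = 0 -> w *m B = 0 -> w = 0.
Hypothesis eta_ker : forall u : 'rV_m, \sum_i u 0 i * a i = 0 ->
  dot (u *m S) eta = 0.
Hypothesis B_ker : forall u v : 'rV_m, \sum_i u 0 i * a i = 0 ->
  \sum_i v 0 i * a i = 0 -> ip B (u *m S) (v *m S) = 0.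

(** The kernel of [a] has dimension at least m - 1, and [S] embeds it as an isotropic subspace on
    which [B] is injective, since [eta] vanishes there. Hence 2 (m - 1) <= m + 1 by
    [isotropic_rank]. *)
Lemma covector_kernel_dim : (m <= 3)%N.
Proof.
pose K : 'cV[R]_m := \col_i a i.
pose E := row_base (kermx K).
have Eker (u : 'rV_(\rank (kermx K))) : \sum_i (u *m E) 0 i * a i = 0.
  have /sub_kermxP H : (u *m E <= kermx K)%MS.
    by rewrite (submx_trans (submxMl _ _)) // eq_row_base.
  transitivity ((u *m E *m K) 0 0); last by rewrite H mxE.
  rewrite [RHS]mxE.
  by apply: eq_bigr => i _; rewrite [K _ _]mxE.
have ES0 (u : 'rV_(\rank (kermx K))) : u *m (E *m S) *m B = 0 -> u = 0.
  rewrite mulmxA => uB; have uES := nondeg (eta_ker (Eker u)) uB.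
  apply: (row_free_inj (row_base_free (kermx K))).
  by apply: (row_free_inj S_free); rewrite uES !mul0mx.
have EBE : E *m S *m B *m (E *m S)^T = 0.
  apply/matrixP => i j; rewrite [RHS]mxE.
  have rE k : row k (E *m S) = delta_mx 0 k *m E *m S by rewrite rowE mulmxA.
  by rewrite mulmx_trmxE !rE; apply: B_ker; exact: Eker.
have := isotropic_rank ES0 EBE.
(* [K] has a single column, so its rank is at most 1. *)
rewrite mxrank_ker; have := rank_leq_col K.
by move: (\rank K) => r; lia.
Qed.

End CovectorKernel.

(** * Two-forms that are proportional to the differential of a one-form *)

Section ProportionalCurl.
Context {R : realType} {m : nat} (V : set 'rV[R]_m).
Context (omega eta : 'I_m -> 'rV[R]_m -> R) (Omega : 'I_m -> 'I_m -> 'rV[R]_m -> R).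
Context (f H : 'rV[R]_m -> R).
Implicit Types (x : 'rV[R]_m) (i j k : 'I_m).
Hypothesis Vo : open V.
Hypothesis omega_C2 : forall i, Ck_on 2 V (omega i).
Hypothesis Omega_C1 : forall i j, Ck_on 1 V (Omega i j).
Hypothesis omega_curl : forall i j x, V x ->
  'D_('e_j) (omega i) x - 'D_('e_i) (omega j) x = - 2 * (H x * Omega j i x).

Let curl i j x : R := 'D_('e_j) (omega i) x - 'D_('e_i) (omega j) x.

Let derivable_D i j k x : V x -> derivable ('D_('e_j) (omega i)) x 'e_k.
Proof. exact: Ck_derivable (Ck_derive j (omega_C2 i)). Qed.

Let is_derive_curl i j k x : V x -> is_derive x 'e_k (curl i j)
  ('D_('e_k) ('D_('e_j) (omega i)) x - 'D_('e_k) ('D_('e_i) (omega j)) x).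
Proof. by move=> Vx; apply: is_deriveB; exact/derivableP/derivable_D. Qed.

(** [omega_curl] reads d omega = - 2 H Omega. Where a component of Omega is nonzero it can be solved
    for [H], whose regularity is not assumed. *)
Lemma proportional_derivable i j k x : V x -> Omega j i x != 0 ->
  derivable H x 'e_k.
Proof.
move=> Vx O0; have cO := Ck_continuous (Omega_C1 j i) Vx.
(* The quotient formula is needed on a neighbourhood of [x], to be differentiated. *)
have nO : \forall y \near x, V y /\ Omega j i y != 0.
  near=> y; split; near: y; first exact: open_nbhs_nbhs.
  exact: cvgr_neq0 cO O0.
pose h y : R := - 2^-1 * (curl i j y * (Omega j i y)^-1).
apply: (@near_eq_derivable _ _ _ h).
  apply: filterS nO => y [Vy Oy]; rewrite /h /curl omega_curl //.
  by field.
have [dc _] := is_derive_curl i j k Vx.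
have dO := derivableV O0 (Ck_derivable (i := k) (Omega_C1 j i) Vx).
have [] // := is_derive_mul (is_derive_cst (- 2^-1 : R) x 'e_k)
  (is_derive_mul (derivableP dc) (derivableP dO)).
Unshelve. all: by end_near. Qed.

Let near_V x (g h : 'rV[R]_m -> R) : V x -> (forall y, V y -> g y = h y) ->
  \forall y \near x, g y = h y.
Proof. by move=> Vx gh; near do apply: gh; exact: open_nbhs_nbhs.
Unshelve. all: by end_near. Qed.

(** From 0 = d d omega = - 2 (dH /\ Omega + H d Omega), where the last term vanishes by the
    closedness assumed at [x]. *)
Lemma proportional_wedge i j k x : V x ->
  (forall k, derivable H x 'e_k) ->
  'D_('e_k) (Omega j i) x + 'D_('e_j) (Omega i k) x + 'D_('e_i) (Omega k j) x = 0 ->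
  'D_('e_k) H x * Omega j i x + 'D_('e_j) H x * Omega i k x
  + 'D_('e_i) H x * Omega k j x = 0.
Proof.
move=> Vx dH closed.
have E p q l : 'D_('e_l) ('D_('e_q) (omega p)) x
    - 'D_('e_l) ('D_('e_p) (omega q)) x =
    - 2 * ('D_('e_l) H x * Omega q p x + H x * 'D_('e_l) (Omega q p) x).
  have [_ <-] := is_derive_curl p q l Vx.
  have -> := near_eq_derive 'e_l (near_V Vx (omega_curl p q)).
  have D := is_derive_mul (is_derive_cst (- 2 : R) x 'e_l)
    (is_derive_mul (derivableP (dH l))
      (derivableP (Ck_derivable (i := l) (Omega_C1 q p) Vx))).
  by have [_ ->] := D; rewrite /cst mul0r add0r.
(* Each primed letter [a'], [b'], [c'] is the mixed second derivative of a component of omega in the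
   other order. The cyclic sum cancels them in pairs. *)
have alg (a b c a' b' c' h A B C A' B' C' : R) :
    a - b = - 2 * (A + h * A') -> c - a' = - 2 * (B + h * B') ->
    b' - c' = - 2 * (C + h * C') -> a' = a -> b' = b -> c' = c ->
    A' + B' + C' = 0 -> A + B + C = 0.
  move=> H1 H2 H3 aE bE cE S.
  have hS : h * A' + h * B' + h * C' = 0 by rewrite -!mulrDr S mulr0.
  by lra.
exact: (alg _ _ _ _ _ _ _ _ _ _ _ _ _ (E i j k) (E k i j) (E j k i)
  (derive_sym j k Vo (omega_C2 i) Vx) (derive_sym i k Vo (omega_C2 j) Vx)
  (derive_sym i j Vo (omega_C2 k) Vx) closed).
Qed.

Hypothesis eta_C1 : forall i, Ck_on 1 V (eta i).
Hypothesis f_C2 : Ck_on 2 V f.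
Hypothesis f_derive : forall i x, V x ->
  'D_('e_i) f x = omega i x - H x * eta i x.
Hypothesis eta_curl : forall i j x, V x ->
  'D_('e_j) (eta i) x - 'D_('e_i) (eta j) x = - 2 * Omega j i x.

(** Here df = omega - H eta and d eta = - 2 Omega. In 0 = d d f the terms d omega and H d eta
    cancel, leaving dH /\ eta = 0. *)
Lemma potential_wedge i k x : V x -> (forall k, derivable H x 'e_k) ->
  'D_('e_i) H x * eta k x = 'D_('e_k) H x * eta i x.
Proof.
move=> Vx dH.
have E p q : 'D_('e_p) ('D_('e_q) f) x = 'D_('e_p) (omega q) x -
    ('D_('e_p) H x * eta q x + H x * 'D_('e_p) (eta q) x).
  have -> := near_eq_derive 'e_p (near_V Vx (f_derive q)).
  have [_ ->] // := is_deriveB (derivableP (Ck_derivable (i := p) (omega_C2 q) Vx))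
    (is_derive_mul (derivableP (dH p)) (derivableP (Ck_derivable (i := p) (eta_C1 q) Vx))).
have alg (a b c d h A B A' B' o : R) : c = a - (A + h * A') ->
    d = b - (B + h * B') -> c = d ->
    b - a = - 2 * (h * o) -> B' - A' = - 2 * o -> A = B.
  by move=> H1 H2 H3 H4 H5; have : h * B' - h * A' = - 2 * (h * o);
    [rewrite -mulrBr H5; ring | lra].
exact: (alg _ _ _ _ _ _ _ _ _ _ (E i k) (E k i) (derive_sym i k Vo f_C2 Vx)
  (omega_curl i k Vx) (eta_curl i k Vx)).
Qed.

End ProportionalCurl.

(** * Umbilical hypersurfaces in coordinates *)

Section LocalHypersurface.
Context {R : realType} {m : nat} (V : set 'rV[R]_m) (W : set 'rV[R]_m.+1).
Context (F nu : 'rV[R]_m -> 'rV[R]_m.+1) (H : 'rV[R]_m -> R).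
Context (G B : 'rV[R]_m.+1 -> 'M[R]_m.+1) (eta : 'rV[R]_m.+1 -> 'rV[R]_m.+1).
Context (Gam : 'rV[R]_m.+1 -> 'I_m.+1 -> 'I_m.+1 -> 'rV[R]_m.+1).
Implicit Types (x : 'rV[R]_m) (y u v w : 'rV[R]_m.+1) (i j k : 'I_m)
  (a b c : 'I_m.+1).

Definition connection_form y u v : 'rV[R]_m.+1 :=
  \sum_a \sum_b (u 0 a * v 0 b) *: Gam y a b.

Definition tangent i x : 'rV[R]_m.+1 := \row_a 'D_('e_i) (fun z => F z 0 a) x.

(** The pull-back to M of the Levi-Civita connection of N, acting on vector fields along [F]. *)
Definition along (Y : 'rV[R]_m -> 'rV[R]_m.+1) i x : 'rV[R]_m.+1 :=
  \row_a 'D_('e_i) (fun z => Y z 0 a) x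
  + connection_form (F x) (tangent i x) (Y x).

Hypothesis Vo : open V.
Hypothesis Wo : open W.
Hypothesis VW : forall x, V x -> W (F x).
Hypothesis F_smooth : forall a, smooth_on V (fun x => F x 0 a).
Hypothesis nu_smooth : forall a, smooth_on V (fun x => nu x 0 a).
Hypothesis B_smooth : forall a b, smooth_on W (fun y => B y a b).
Hypothesis eta_smooth : forall a, smooth_on W (fun y => eta y 0 a).
Hypothesis Gam_sym : forall y a b, W y -> Gam y a b = Gam y b a.
Hypothesis G_sym : forall y, W y -> (G y)^T = G y.
Hypothesis B_skew : forall y, W y -> (B y)^T = - B y.
(* (nabla_X B)(Y, Z) = g(X, Y) eta(Z) - eta(Y) g(X, Z) *)
Hypothesis B_derive : forall y c a b, W y ->
  'D_('e_c) (fun z => B z a b) y =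
    ip (B y) (Gam y c a) 'e_b + ip (B y) 'e_a (Gam y c b)
    + (G y c a * eta y 0 b - eta y 0 a * G y c b).
(* The alternatives are those of the Kaehler and of the Sasakian case. *)
Hypothesis eta_derive : (forall y, W y -> eta y = 0) \/
  (forall y c a, W y ->
     'D_('e_c) (fun z => eta z 0 a) y = dot (Gam y c a) (eta y) - B y c a).
Hypothesis nondeg : forall y w, W y -> dot w (eta y) = 0 -> w *m B y = 0 ->
  w = 0.
Hypothesis immersion : forall x, V x -> row_free (\matrix_i tangent i x).
Hypothesis normal : forall x i, V x -> ip (G (F x)) (nu x) (tangent i x) = 0.
Hypothesis umbilical : forall x i, V x -> along nu i x = - (H x *: tangent i x).

Lemma connection_form_sym y u v : W y ->
  connection_form y u v = connection_form y v u.
Proof.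
move=> Wy; rewrite /connection_form exchange_big /=; apply: eq_bigr => a _.
by apply: eq_bigr => b _; rewrite Gam_sym // mulrC.
Qed.

Lemma derive_comp x k (f : 'rV[R]_m.+1 -> R) : V x -> smooth_on W f ->
  is_derive x 'e_k (f \o F) (\sum_c tangent k x 0 c * 'D_('e_c) f (F x)).
Proof.
move=> Vx sf; apply: is_derive_eq.
  apply: (C1_chain Wo (sf 1%N) (VW Vx)) => a.
  exact: Ck_derivable (F_smooth a 1%N) Vx.
by apply: eq_bigr => c _; rewrite mxE.
Qed.

Lemma connection_formE y u v :
  connection_form y u v = \sum_c u 0 c *: \sum_a v 0 a *: Gam y c a.
Proof.
apply: eq_bigr => c _; rewrite scaler_sumr; apply: eq_bigr => a _.
by rewrite scalerA.
Qed.

Lemma B_derive_bilinear y c v w : W y ->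
  ip (\matrix_(a, b) 'D_('e_c) (fun z => B z a b) y) v w =
  ip (B y) (\sum_a v 0 a *: Gam y c a) w + ip (B y) v (\sum_a w 0 a *: Gam y c a)
  + (ip (G y) 'e_c v * dot w (eta y) - dot v (eta y) * ip (G y) 'e_c w).
Proof.
move=> Wy.
have T1 : ip (B y) (\sum_a v 0 a *: Gam y c a) w =
    \sum_a \sum_b v 0 a * w 0 b * ip (B y) (Gam y c a) 'e_b.
  rewrite ip_suml; apply: eq_bigr => a _; rewrite ipZl ip_col mulr_sumr.
  by apply: eq_bigr => b _; rewrite mulrA.
have T2 : ip (B y) v (\sum_a w 0 a *: Gam y c a) =
    \sum_a \sum_b v 0 a * w 0 b * ip (B y) 'e_a (Gam y c b).
  rewrite ip_row; apply: eq_bigr => a _; rewrite ip_sumr mulr_sumr.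
  by apply: eq_bigr => b _; rewrite ipZr mulrA.
have T3 : ip (G y) 'e_c v * dot w (eta y) =
    \sum_a \sum_b v 0 a * w 0 b * (G y c a * eta y 0 b).
  rewrite ip_col dotE big_distrlr /=; apply: eq_bigr => a _.
  by apply: eq_bigr => b _; rewrite ip_ebase; ring.
have T4 : dot v (eta y) * ip (G y) 'e_c w =
    \sum_a \sum_b v 0 a * w 0 b * (eta y 0 a * G y c b).
  rewrite ip_col dotE big_distrlr /=; apply: eq_bigr => a _.
  by apply: eq_bigr => b _; rewrite ip_ebase; ring.
rewrite T1 T2 T3 T4 ipE -sumrB -!big_split /=; apply: eq_bigr => a _.
rewrite -sumrB -!big_split /=; apply: eq_bigr => b _.
by rewrite mxE B_derive //; ring.
Qed.

(** Extends [B_derive] from basis vectors to arbitrary [u], [v], [w] by linearity, the first step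
    being [B_derive_bilinear]. *)
Lemma B_derive_trilinear y u v w : W y ->
  ip (\matrix_(a, b) \sum_c u 0 c * 'D_('e_c) (fun z => B z a b) y) v w =
  ip (B y) (connection_form y u v) w + ip (B y) v (connection_form y u w)
  + (ip (G y) u v * dot w (eta y) - dot v (eta y) * ip (G y) u w).
Proof.
move=> Wy.
have -> : ip (\matrix_(a, b) \sum_c u 0 c * 'D_('e_c) (fun z => B z a b) y) v w =
    \sum_c u 0 c * ip (\matrix_(a, b) 'D_('e_c) (fun z => B z a b) y) v w.
  under [RHS]eq_bigr do rewrite ipE mulr_sumr.
  rewrite ipE [RHS]exchange_big /=; apply: eq_bigr => a _.
  under [RHS]eq_bigr do rewrite mulr_sumr.
  rewrite [RHS]exchange_big /=; apply: eq_bigr => b _.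
  by rewrite mxE mulr_sumr; apply: eq_bigr => c _; rewrite mxE; ring.
rewrite !connection_formE ip_suml ip_sumr (ip_row _ u v) (ip_row _ u w).
rewrite mulr_suml mulr_sumr -sumrB -!big_split /=; apply: eq_bigr => c _.
by rewrite B_derive_bilinear // ipZl ipZr; ring.
Qed.

(** The Leibniz rule along [F]: the Christoffel terms in the derivative of [B] complete the partial
    derivatives of [Y] and [Z] to [along], and what remains is (nabla B)(Y, Z). *)
Lemma is_derive_B (Y Z : 'rV[R]_m -> 'rV[R]_m.+1) k x : V x ->
  (forall a, derivable (fun z => Y z 0 a) x 'e_k) ->
  (forall a, derivable (fun z => Z z 0 a) x 'e_k) ->
  is_derive x 'e_k (fun z => ip (B (F z)) (Y z) (Z z))
    (ip (B (F x)) (along Y k x) (Z x) + ip (B (F x)) (Y x) (along Z k x)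
     + (ip (G (F x)) (tangent k x) (Y x) * dot (Z x) (eta (F x))
        - dot (Y x) (eta (F x)) * ip (G (F x)) (tangent k x) (Z x))).
Proof.
move=> Vx dY dZ; have Wx := VW Vx; apply: is_derive_eq.
  apply: (@is_derive_ip _ _ _ (B \o F) Y Z x 'e_k
    (\matrix_(a, b) \sum_c tangent k x 0 c * 'D_('e_c) (fun z => B z a b) (F x))
    (\row_a 'D_('e_k) (fun z => Y z 0 a) x)
    (\row_a 'D_('e_k) (fun z => Z z 0 a) x)) => [a b|a|a]; rewrite mxE.
  - exact: derive_comp Vx (B_smooth a b).
  - exact: derivableP.
  - exact: derivableP.
rewrite B_derive_trilinear // /along !ipDl !ipDr /=; ring.
Qed.

(** The Leibniz rule with (nabla_X eta)(Y) = - B(X, Y), which is the assumed formula for the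
    derivatives of [eta]. *)
Lemma is_derive_eta (Y : 'rV[R]_m -> 'rV[R]_m.+1) k x :
  (forall y c a, W y ->
     'D_('e_c) (fun z => eta z 0 a) y = dot (Gam y c a) (eta y) - B y c a) ->
  V x -> (forall a, derivable (fun z => Y z 0 a) x 'e_k) ->
  is_derive x 'e_k (fun z => dot (Y z) (eta (F z)))
    (dot (along Y k x) (eta (F x)) - ip (B (F x)) (tangent k x) (Y x)).
Proof.
move=> De Vx dY; have Wx := VW Vx; apply: is_derive_eq.
  (* [dot] is [ip] of the constant identity matrix, whose derivative is 0. *)
  apply: (@is_derive_ip _ _ _ (cst 1%:M) Y (eta \o F) x 'e_k 0
    (\row_a 'D_('e_k) (fun z => Y z 0 a) x)
    (\row_a \sum_c tangent k x 0 c * 'D_('e_c) (fun z => eta z 0 a) (F x)))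
    => [a b|a|a]; rewrite [X in is_derive _ _ _ X]mxE.
  - exact: is_derive_cst.
  - exact: derivableP.
  - exact: derive_comp Vx (eta_smooth a).
rewrite -!/(dot _ _) /= [ip 0 _ _]ipE [X in _ + X]big1 ?addr0; last first.
  by move=> a _; apply: big1 => b _; rewrite mxE mulr0.
rewrite /along /dot ipDl -!/(dot _ _) -addrA; congr (_ + _).
set y := F x in Wx *; set u := tangent k x.
rewrite dotE connection_formE /dot ip_suml -/dot.
transitivity (\sum_c u 0 c * (\sum_a Y x 0 a * dot (Gam y c a) (eta y)
    - ip (B y) 'e_c (Y x))).
  under [RHS]eq_bigr do rewrite ip_col -sumrB mulr_sumr.
  rewrite [RHS]exchange_big /=; apply: eq_bigr => a _.
  rewrite mxE mulr_sumr; apply: eq_bigr => c _.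
  by rewrite De // ip_ebase; ring.
rewrite [ip _ u _]ip_row -sumrB; apply: eq_bigr => c _.
rewrite mulrBr ipZl ip_suml; congr (_ * _ - _).
by apply: eq_bigr => a _; rewrite ipZl.
Qed.

(** Three forms on M: [Omega] and [etaM] are the pull-backs of [B] and [eta] by [F], and [omega] is
    the pull-back of the contraction of [B] with the normal. *)
Let omega i x := ip (B (F x)) (nu x) (tangent i x).
Let Omega i j x := ip (B (F x)) (tangent i x) (tangent j x).
Let etaM i x := dot (tangent i x) (eta (F x)).

Lemma tangent_smooth i a : smooth_on V (fun x => tangent i x 0 a).
Proof.
move=> k; have -> : (fun x => tangent i x 0 a) = 'D_('e_i) (fun z => F z 0 a).
  by apply/funext => x; rewrite mxE.
exact/Ck_derive/F_smooth.
Qed.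

Lemma comp_smooth (f : 'rV[R]_m.+1 -> R) : smooth_on W f -> smooth_on V (f \o F).
Proof. by move=> sf k; apply: Ck_comp (sf k) _ => // a; exact: F_smooth. Qed.

Lemma omega_smooth i : smooth_on V (omega i).
Proof.
move=> k; apply: (Ck_ip (M := B \o F)) => // [a b|a|a].
- exact: (comp_smooth (B_smooth a b)).
- exact: nu_smooth.
- exact: tangent_smooth.
Qed.

Lemma Omega_smooth i j : smooth_on V (Omega i j).
Proof.
move=> k; apply: (Ck_ip (M := B \o F)) => // [a b|a|a].
- exact: (comp_smooth (B_smooth a b)).
- exact: tangent_smooth.
- exact: tangent_smooth.
Qed.

(** Second derivatives of [F] commute, and the connection has no torsion. *)
Lemma along_tangent_sym i k x : V x -> along (tangent i) k x = along (tangent k) i x.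
Proof.
move=> Vx.
have E l : forall a, (fun z => tangent l z 0 a) = 'D_('e_l) (fun z => F z 0 a).
  by move=> a; apply/funext => z; rewrite mxE.
have S : \row_a 'D_('e_k) (fun z => tangent i z 0 a) x =
    \row_a 'D_('e_i) (fun z => tangent k z 0 a) x.
  apply/rowP => a; rewrite [LHS]mxE [RHS]mxE.
  apply: etrans (congr1 (fun h => 'D_('e_k) h x) (E i a)) _.
  apply: etrans (derive_sym k i Vo (F_smooth a 2%N) Vx) _.
  exact: (congr1 (fun h => 'D_('e_i) h x) (esym (E k a))).
exact: (congr2 +%R S (connection_form_sym _ _ (VW Vx))).
Qed.

Lemma Omega_skew i j x : V x -> Omega i j x = - Omega j i x.
Proof. by move=> Vx; apply/ip_skew/B_skew/VW. Qed.

(** In [is_derive_B], umbilicity turns the derivative of [nu] into [- H] times a tangent vector, and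
    orthogonality removes one of the two terms of nabla B. *)
Lemma is_derive_omega i j x : V x ->
  is_derive x 'e_j (omega i)
    (- (H x * Omega j i x) + ip (B (F x)) (nu x) (along (tangent i) j x)
     - dot (nu x) (eta (F x)) * ip (G (F x)) (tangent j x) (tangent i x)).
Proof.
move=> Vx; apply: is_derive_eq.
  apply: is_derive_B => // a; first exact: Ck_derivable (nu_smooth a 1%N) Vx.
  exact: Ck_derivable (tangent_smooth i a 1%N) Vx.
rewrite umbilical // -scaleNr ipZl (ip_sym _ (nu x) (G_sym (VW Vx))).
by rewrite normal // /Omega; ring.
Qed.

(** The terms with [along] and with the metric are symmetric in [i] and [j] and cancel; the skew
    term in [Omega] is doubled. *)
Lemma omega_curl i j x : V x ->
  'D_('e_j) (omega i) x - 'D_('e_i) (omega j) x = - 2 * (H x * Omega j i x).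
Proof.
move=> Vx; have [_ E1] := is_derive_omega i j Vx.
have [_ E2] := is_derive_omega j i Vx.
have alg (d1 d2 h o1 o2 p q e g1 g2 : R) : d1 = - (h * o1) + p - e * g1 ->
    d2 = - (h * o2) + q - e * g2 -> p = q -> o2 = - o1 -> g2 = g1 ->
    d1 - d2 = - 2 * (h * o1).
  by move=> -> -> -> -> ->; ring.
apply: (alg _ _ _ _ _ _ _ _ _ _ E1 E2).
- exact: (congr1 (ip (B (F x)) (nu x)) (along_tangent_sym i j Vx)).
- exact: Omega_skew.
- exact/ip_sym/G_sym/VW.
Qed.

(** Each derivative is expressed by A(p, q, r) = B(nabla_q t_p, t_r), with t the tangent vectors,
    and by the metric. Both are symmetric in their first two indices, so the cyclic sum cancels. *)
Lemma Omega_closed i j k x : V x ->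
  'D_('e_k) (Omega j i) x + 'D_('e_j) (Omega i k) x + 'D_('e_i) (Omega k j) x = 0.
Proof.
move=> Vx; have Wx := VW Vx.
have alg (D A : 'I_m -> 'I_m -> 'I_m -> R) (g : 'I_m -> 'I_m -> R) (e : 'I_m -> R) :
    (forall l p q, D l p q = A p l q - A q l p + (g l p * e q - e p * g l q)) ->
    (forall p q r, A p q r = A q p r) -> (forall p q, g p q = g q p) ->
    D k j i + D j i k + D i k j = 0.
  move=> DE As gs; rewrite !DE (As j k) (As i k) (As i j) (gs k j) (gs k i).
  by rewrite (gs j i); ring.
pose A p q r := ip (B (F x)) (along (tangent p) q x) (tangent r x).
pose g p q := ip (G (F x)) (tangent p x) (tangent q x).
apply: (alg (fun l p q => 'D_('e_l) (Omega p q) x) A g (fun i => etaM i x)).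
- move=> l p q; have [_ E] := is_derive_B (k := l) Vx
    (fun a => Ck_derivable (tangent_smooth p a 1%N) Vx)
    (fun a => Ck_derivable (tangent_smooth q a 1%N) Vx).
  apply: etrans E _; rewrite -/(g l p) -/(g l q).
  by congr (_ + _ + _); exact/ip_skew/B_skew.
- move=> p q r.
  exact: (congr1 (fun v => ip (B (F x)) v (tangent r x))
    (along_tangent_sym p q Vx)).
- by move=> p q; exact/ip_sym/G_sym.
Qed.

Lemma is_derive_etaM i j x :
  (forall y c a, W y ->
     'D_('e_c) (fun z => eta z 0 a) y = dot (Gam y c a) (eta y) - B y c a) ->
  V x -> is_derive x 'e_j (etaM i)
    (dot (along (tangent i) j x) (eta (F x)) - Omega j i x).
Proof.
move=> De Vx; apply: is_derive_eta => // a.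
exact: Ck_derivable (tangent_smooth i a 1%N) Vx.
Qed.

Lemma dot_smooth (Y : 'rV[R]_m -> 'rV[R]_m.+1) :
  (forall a, smooth_on V (fun x => Y x 0 a)) ->
  smooth_on V (fun x => dot (Y x) (eta (F x))).
Proof.
move=> sY k; apply: (Ck_ip (M := cst 1%:M) (Z := eta \o F)) => // [a b|a|a].
- exact: Ck_cst.
- exact: sY.
- exact: (comp_smooth (eta_smooth a)).
Qed.

(** Trivial in the Kaehler case, where [etaM] is 0. In the Sasakian case [potential_wedge] applies
    to the potential eta(nu). *)
Lemma eta_wedge i k x : V x -> (forall k, derivable H x 'e_k) ->
  'D_('e_i) H x * etaM k x = 'D_('e_k) H x * etaM i x.
Proof.
move=> Vx dH; case: eta_derive => [eta0|De].
  have e0 l : etaM l x = 0 by rewrite /etaM (eta0 _ (VW Vx)); exact: ip0r.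
  have alg (a b c d : R) : c = 0 -> d = 0 -> a * c = b * d.
    by move=> -> ->; rewrite !mulr0.
  exact: alg.
pose f z := dot (nu z) (eta (F z)).
have fD l z : V z -> 'D_('e_l) f z = omega l z - H z * etaM l z.
  move=> Vz; have [_ E] := is_derive_eta (k := l) De Vz
    (fun a => Ck_derivable (nu_smooth a 1%N) Vz).
  apply: etrans E _; rewrite umbilical // /dot -scaleNr ipZl.
  by rewrite (ip_skew _ _ (B_skew (VW Vz))) opprK addrC mulNr.
have eD p q z : V z ->
    'D_('e_q) (etaM p) z - 'D_('e_p) (etaM q) z = - 2 * Omega q p z.
  move=> Vz; have [_ E1] := is_derive_etaM p q De Vz.
  have [_ E2] := is_derive_etaM q p De Vz.
  have alg (d1 d2 a b o1 o2 : R) : d1 = a - o1 -> d2 = b - o2 -> a = b ->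
    o2 = - o1 -> d1 - d2 = - 2 * o1 by move=> -> -> -> ->; ring.
  apply: (alg _ _ _ _ _ _ E1 E2 _ (Omega_skew _ _ Vz)).
  exact: (congr1 (fun v => dot v (eta (F z))) (along_tangent_sym p q Vz)).
exact: (potential_wedge Vo (fun i => omega_smooth i 2%N) omega_curl
  (fun p => dot_smooth (tangent_smooth p) 1%N) (dot_smooth nu_smooth 2%N)
  fD eD).
Qed.

Let S x : 'M[R]_(m, m.+1) := \matrix_i tangent i x.

Let mul_S (u : 'rV[R]_m) x : u *m S x = \sum_i u 0 i *: tangent i x.
Proof.
by rewrite mulmx_sum_row; apply: eq_bigr => i _; rewrite rowK.
Qed.

(** Used twice: with [etaM] for [a], to see that [Omega] does not vanish, and with dH for [a], to
    reach the final contradiction. *)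
Let dim_le3 x (a : 'I_m -> R) : V x ->
  (forall u : 'rV_m, \sum_i u 0 i * a i = 0 -> \sum_i u 0 i * etaM i x = 0) ->
  (forall u v : 'rV_m, \sum_i u 0 i * a i = 0 -> \sum_i v 0 i * a i = 0 ->
    \sum_i u 0 i * \sum_j v 0 j * Omega i j x = 0) -> (m <= 3)%N.
Proof.
move=> Vx Ha HO; have Wx := VW Vx.
apply: (covector_kernel_dim (S := S x) (B := B (F x)) (eta := eta (F x)) (a := a)).
- exact: immersion.
- by move=> w; exact: nondeg.
- move=> u /Ha <-; rewrite mul_S /dot ip_suml; apply: eq_bigr => i _.
  by rewrite ipZl.
move=> u v u0 v0; rewrite -(HO u v u0 v0).
rewrite !mul_S ip_suml; apply: eq_bigr => i _; rewrite ipZl; congr (_ * _).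
by rewrite ip_sumr; apply: eq_bigr => j _; rewrite ipZr.
Qed.

Let Omega_wedge i j k x : V x -> (forall k, derivable H x 'e_k) ->
  'D_('e_k) H x * Omega j i x + 'D_('e_j) H x * Omega i k x
  + 'D_('e_i) H x * Omega k j x = 0.
Proof.
move=> Vx dH; apply: (proportional_wedge Vo _ _ omega_curl Vx dH).
- by move=> p; exact: omega_smooth.
- by move=> p q; exact: Omega_smooth.
- exact: Omega_closed.
Qed.

Lemma umbilical_constant x i : (4 <= m)%N -> V x -> is_derive x 'e_i H 0.
Proof.
move=> m4 Vx; have Wx := VW Vx.
(* If [Omega] vanished at [x], then the kernel of [etaM] would already be isotropic and too
   large. *)
have [[p q] /= Opq] : exists pq, Omega pq.1 pq.2 x != 0.
  apply: contrapT => O0.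
  suff : (m <= 3)%N by rewrite leqNgt m4.
  apply: (@dim_le3 x (etaM^~ x)) => // u v _ _.
  apply: big1 => k _; rewrite big1 ?mulr0 // => l _.
  have [->|Okl] := eqVneq (Omega k l x) 0; first by rewrite mulr0.
  by case: O0; exists (k, l).
have dH k : derivable H x 'e_k.
  exact: (proportional_derivable Vo (fun i => omega_smooth i 2%N)
    (fun i j => Omega_smooth i j 1%N) omega_curl (i := q) (j := p)).
(* If the i-th derivative of [H] is nonzero, the two wedge identities make [etaM] and [Omega] vanish
   on the kernel of dH. *)
apply: DeriveDef => //; apply: contrapT => /eqP Hi0.
suff : (m <= 3)%N by rewrite leqNgt m4.
apply: (@dim_le3 x (fun k => 'D_('e_k) H x)) => //.
  move=> u u0; exact: (wedge1_kernel Hi0 (fun k => eta_wedge i k Vx dH) u0).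
move=> u v u0 v0.
exact: (wedge2_kernel Hi0 (fun j k => Omega_wedge i j k Vx dH) u0 v0).
Qed.

End LocalHypersurface.

(** * The fundamental forms of Kaehler and Sasakian manifolds in a chart *)

Section Determinant.
Context {R : realType} {m : nat} (U : set 'rV[R]_m) (k : nat).
Hypothesis Uo : open U.

Lemma Ck_det n (A : 'rV[R]_m -> 'M[R]_n) :
  (forall i j, Ck_on k U (fun x => A x i j)) -> Ck_on k U (fun x => \det (A x)).
Proof.
elim: n A => [|n IH] A CA.
  by under eq_fun do rewrite det_mx00; exact: Ck_cst.
under eq_fun do rewrite (expand_det_row _ 0).
apply: Ck_sum => // j; apply: Ck_mul => //; apply: Ck_mul => //.
  exact: Ck_cst.
by apply: IH => a b; under eq_fun do rewrite !mxE; exact: CA.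
Qed.

Lemma Ck_adj n (A : 'rV[R]_m -> 'M[R]_n) i j :
  (forall i j, Ck_on k U (fun x => A x i j)) ->
  Ck_on k U (fun x => (\adj (A x)) i j).
Proof.
move=> CA; under eq_fun do rewrite mxE.
apply: Ck_mul => //; first exact: Ck_cst.
by apply: Ck_det => a b; under eq_fun do rewrite !mxE; exact: CA.
Qed.

End Determinant.

(** By Cramer's rule, from the determinant and the adjugate. It serves to recover the endomorphism
    [A] from its lowered form [B]. *)
Lemma derivable_invmx (R : realType) (m n : nat) (U : set 'rV[R]_m)
    (A : 'rV[R]_m -> 'M[R]_n) x i j k : open U ->
  (forall i j, Ck_on 1 U (fun x => A x i j)) -> U x ->
  (forall y, U y -> A y \in unitmx) ->
  derivable (fun y => invmx (A y) i j) x 'e_k.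
Proof.
move=> Uo CA Ux Au; pose h y := (\det (A y))^-1 * (\adj (A y)) i j.
have nU : nbhs x U by exact: open_nbhs_nbhs.
apply: (@near_eq_derivable _ _ _ h).
  by apply: filterS nU => y Uy; rewrite /invmx (Au y Uy) [RHS]mxE.
have dn0 : \det (A x) != 0 by rewrite -unitfE -unitmxE Au.
have dd := derivableV (f := fun y => \det (A y)) dn0
  (Ck_derivable (i := k) (Ck_det Uo CA) Ux).
have [] // := is_derive_mul (derivableP dd)
  (derivableP (Ck_derivable (i := k) (Ck_adj Uo i j CA) Ux)).
Qed.

(** * The structure tensors in one chart *)

Section LocalStructure.
Context {R : realType} {n : nat} (W : set 'rV[R]_n).
Context (G A : 'rV[R]_n -> 'M[R]_n) (xi : 'rV[R]_n -> 'rV[R]_n).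
Context (Gam : 'rV[R]_n -> 'I_n -> 'I_n -> 'rV[R]_n).
Implicit Types (y v w : 'rV[R]_n) (a b c : 'I_n).
Hypothesis Wo : open W.
Hypothesis G_smooth : forall a b, smooth_on W (fun y => G y a b).
Hypothesis G_sym : forall y, W y -> (G y)^T = G y.
Hypothesis G_pos : forall y v, W y -> v != 0 -> 0 < ip (G y) v v.
Hypothesis compat : forall y c a b, W y -> 'D_('e_c) (fun z => G z a b) y =
  ip (G y) (Gam y c a) 'e_b + ip (G y) 'e_a (Gam y c b).
Hypothesis A_sqr : forall y w, W y ->
  w *m A y *m A y = - w + ip (G y) (xi y) w *: xi y.
Hypothesis A_covd : forall y c a, W y ->
  \row_b 'D_('e_c) (fun z => A z a b) y + \sum_b A y a b *: Gam y c b
  - Gam y c a *m A y = G y c a *: xi y - ip (G y) (xi y) 'e_a *: 'e_c.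

(** Row [a] of [A] is the image of ['e_a], so [B] is the Gram matrix of g(A X, Y); [eta] holds the
    components of the 1-form dual to [xi]. *)
Let B y := A y *m G y.
Let eta y := xi y *m G y.

Let G_inj y v : W y -> v *m G y = 0 -> v = 0.
Proof.
move=> Wy vG; apply: contrapT => /eqP/(G_pos Wy).
by rewrite /ip vG mul0mx mxE ltxx.
Qed.

Lemma ip_mulmx M (M' : 'M[R]_n) v w : ip (M' *m M) v w = ip M (v *m M') w.
Proof. by rewrite /ip !mulmxA. Qed.

Lemma dot_lower y w : dot w (eta y) = ip (G y) (xi y) w.
Proof. by rewrite dotC /dot /ip mulmx1. Qed.

Lemma lower_ebase y a : eta y 0 a = ip (G y) (xi y) 'e_a.
Proof. by rewrite -dot_lower dot_ebase. Qed.

(** As [G] is invertible, [A] kills [w]; with eta(w) = 0 the formula for the square of [A] becomes 0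
    = - w. *)
Lemma structure_nondeg y w : W y -> dot w (eta y) = 0 -> w *m B y = 0 -> w = 0.
Proof.
rewrite dot_lower => Wy we; rewrite mulmxA => /(G_inj Wy) wA.
have := A_sqr w Wy; rewrite wA mul0mx we scale0r addr0 => /eqP.
by rewrite eq_sym oppr_eq0 => /eqP.
Qed.

Lemma G_unit y : W y -> G y \in unitmx.
Proof.
by move=> Wy; rewrite -row_free_unit; apply: inj_row_free => v; exact: G_inj.
Qed.

(** Lowering an index commutes with covariant differentiation, because nabla g = 0. *)
Let is_derive_lower (Y : 'rV[R]_n -> 'rV[R]_n) y c b : W y ->
  (forall a, derivable (fun z => Y z 0 a) y 'e_c) ->
  is_derive y 'e_c (fun z => (Y z *m G z) 0 b)
    (ip (G y) (\row_a 'D_('e_c) (fun z => Y z 0 a) y + \sum_a Y y 0 a *: Gam y c a) 'e_b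
     + ip (G y) (Y y) (Gam y c b)).
Proof.
move=> Wy dY; under eq_fun do rewrite mxE.
have D a : is_derive y 'e_c (fun z => Y z 0 a * G z a b)
   ('D_('e_c) (fun z => Y z 0 a) y * G y a b + Y y 0 a *
     (ip (G y) (Gam y c a) 'e_b + ip (G y) 'e_a (Gam y c b))).
  rewrite -compat //.
  apply: is_derive_mul; apply: derivableP => //.
  exact: Ck_derivable (G_smooth a b 1%N) Wy.
apply: is_derive_eq (is_derive_bigsum D) _.
rewrite ipDl ip_suml [ip _ (\row__ _) _]ip_row [ip _ (Y y) _]ip_row.
rewrite -!big_split /=; apply: eq_bigr => a _.
by rewrite mxE ip_ebase ipZl; ring.
Qed.

(** [A_covd] with its values lowered by [G]. Derivability of [A] is a premise because the two kinds
    of structure obtain it in different ways. *)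
Lemma structure_B_derive y c a b : W y ->
  (forall b, derivable (fun z => A z a b) y 'e_c) ->
  'D_('e_c) (fun z => B z a b) y =
    ip (B y) (Gam y c a) 'e_b + ip (B y) 'e_a (Gam y c b)
    + (G y c a * eta y 0 b - eta y 0 a * G y c b).
Proof.
move=> Wy dA.
have E z : row a (A z) *m G z = row a (B z) by rewrite row_mul.
have dY b' : derivable (fun z => row a (A z) 0 b') y 'e_c.
  by under eq_fun do rewrite mxE; exact: dA.
have [_ D] := is_derive_lower b Wy dY.
transitivity ('D_('e_c) (fun z => (row a (A z) *m G z) 0 b) y).
  by congr ('D_('e_c) _ y); apply/funext => z; rewrite E [RHS]mxE.
apply: etrans D _.
have -> : \row_b 'D_('e_c) (fun z => row a (A z) 0 b) y
    + \sum_b row a (A y) 0 b *: Gam y c b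
  = Gam y c a *m A y + (G y c a *: xi y - ip (G y) (xi y) 'e_a *: 'e_c).
  rewrite -A_covd // [RHS]addrC subrK; congr (_ + _).
    apply/rowP => e; rewrite [LHS]mxE [RHS]mxE; congr ('D_('e_c) _ y).
    by apply/funext => z; rewrite mxE.
  by apply: eq_bigr => e _; rewrite mxE.
rewrite ipDl ipDl -scaleNr !ipZl /B !ip_mulmx !lower_ebase ip_ebase -rowE.
ring.
Qed.

Section Reeb.
Hypothesis xi_smooth : forall a, smooth_on W (fun y => xi y 0 a).
Hypothesis xi_covd : forall y c, W y ->
  \row_a 'D_('e_c) (fun z => xi z 0 a) y + \sum_a xi y 0 a *: Gam y c a
  = - row c (A y).
Hypothesis B_skew : forall y, W y -> (B y)^T = - B y.
Hypothesis Gam_sym : forall y a b, W y -> Gam y a b = Gam y b a.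

Lemma lower_smooth a : smooth_on W (fun y => eta y 0 a).
Proof.
move=> k; under eq_fun do rewrite mxE.
by apply: Ck_sum => // b; apply: Ck_mul => //; [exact: xi_smooth|exact: G_smooth].
Qed.

(** Lowering nabla xi = - A gives nabla eta = - B. *)
Lemma structure_eta_derive y c a : W y ->
  'D_('e_c) (fun z => eta z 0 a) y = dot (Gam y c a) (eta y) - B y c a.
Proof.
move=> Wy; have [_ D] := is_derive_lower (c := c) a Wy
  (fun a => Ck_derivable (xi_smooth a 1%N) Wy).
apply: etrans D _; rewrite xi_covd // dot_lower addrC; congr (_ + _).
by rewrite -scaleN1r ipZl mulN1r rowE -ip_mulmx ip_ebase.
Qed.

(* A = - nabla xi involves the connection, whose smoothness is not a datum: that
   of B comes from B = - d eta / 2. *)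
Lemma structure_B_smooth a b : smooth_on W (fun y => B y a b).
Proof.
move=> k.
pose h y := - 2^-1 * ('D_('e_a) (fun z => eta z 0 b) y
  + - 1 * 'D_('e_b) (fun z => eta z 0 a) y).
(* The Christoffel terms of the two derivatives agree by symmetry and cancel in the difference. *)
have hB y : W y -> h y = B y a b.
  move=> Wy; have [D1 D2] := (structure_eta_derive a b Wy, structure_eta_derive b a Wy).
  have skew : B y b a = - B y a b by have /matrixP/(_ a b) := B_skew Wy; rewrite !mxE.
  have alg (d1 d2 s t b1 b2 : R) : d1 = s - b1 -> d2 = t - b2 -> s = t -> b2 = - b1 ->
      - 2^-1 * (d1 + - 1 * d2) = b1.
    by move=> -> -> -> ->; field.
  by apply: (alg _ _ _ _ _ _ D1 D2 _ skew); rewrite Gam_sym.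
apply: (Ck_ext Wo hB); apply: Ck_mul => //; first exact: Ck_cst.
apply: Ck_add => //; first exact/Ck_derive/lower_smooth.
by apply: Ck_mul => //; [exact: Ck_cst|exact/Ck_derive/lower_smooth].
Qed.

(** Write [A] as [B] times the inverse of [G], both factors being derivable. *)
Lemma structure_A_derivable y a b c : W y -> derivable (fun z => A z a b) y 'e_c.
Proof.
move=> Wy; have nW : nbhs y W by exact: open_nbhs_nbhs.
apply: (@near_eq_derivable _ _ _ (fun z => \sum_e B z a e * invmx (G z) e b)).
  apply: filterS nW => z Wz.
  transitivity ((B z *m invmx (G z)) a b); first by rewrite [RHS]mxE.
  by rewrite /B mulmxK ?G_unit.
have D e := is_derive_mul
  (derivableP (Ck_derivable (i := c) (structure_B_smooth a e 1%N) Wy))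
  (derivableP (derivable_invmx (i := e) (j := b) (k := c) Wo
    (fun i j => G_smooth i j 1%N) Wy G_unit)).
by have [] := is_derive_bigsum D.
Qed.

End Reeb.
End LocalStructure.

(** * From charts to coordinates *)

Section Charts.
Context {R : realType} {n : nat} {T : topologicalType} (c : chart R n T).

Lemma smooth_in_on (U : set T) (V : set 'rV[R]_n) (f : T -> R) :
  (forall x, V x -> cod c x /\ U (crdV c x)) -> smooth_in c U f ->
  smooth_on V (f \o crdV c).
Proof.
move=> VU sf k; apply: Ck_sub (sf k) => x /VU[cx Ux].
by exists (crdV c x); [split=> //; exact: crdV_dom|exact: crdVK].
Qed.

Lemma pd_crdV i (f : T -> R) x : cod c x ->
  pd c i f (crdV c x) = 'D_('e_i) (f \o crdV c) x.
Proof. by move=> cx; rewrite /pd crdVK. Qed.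

Lemma open_chart_preimage (U : set T) : open U ->
  open (cod c `&` crdV c @^-1` U).
Proof.
move=> Uo; rewrite openE => x [cx Ux]; apply: filterI.
  exact: open_nbhs_nbhs (conj (@cod_open _ _ _ c) cx).
exact: (crdV_continuous cx (open_nbhs_nbhs (conj Uo Ux))).
Qed.

End Charts.

Section ChartStructure.
Context {R : realType} {m : nat} {N : manifold R m.+1} {g : metric N}.
Context (D : levi_civita g) (d : atlas N).

Let W := cod (chart_of d).
Let at_chart (A : Type) (f : atlas N -> N -> A) (y : 'rV[R]_m.+1) : A :=
  f d (crdV (chart_of d) y).
Let G := at_chart g.
Let Gam := at_chart (christ D).

Let domW y : W y -> dom (chart_of d) (crdV (chart_of d) y).
Proof. exact: crdV_dom. Qed.

Let Wo : open W. Proof. exact: cod_open. Qed.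

Let smooth_W f : smooth_in (chart_of d) [set: N] f ->
  smooth_on W (f \o crdV (chart_of d)).
Proof. exact: smooth_in_on. Qed.

Let G_smooth a b : smooth_on W (fun y => G y a b).
Proof. exact: smooth_W (metr_smooth g d a b). Qed.

Let G_sym y : W y -> (G y)^T = G y.
Proof. by move=> Wy; exact/metr_sym/domW. Qed.

Let G_pos y v : W y -> v != 0 -> 0 < ip (G y) v v.
Proof. by move=> Wy; exact/metr_pos/domW. Qed.

Let Gam_sym y a b : W y -> Gam y a b = Gam y b a.
Proof. by move=> Wy; exact/torsion_free/domW. Qed.

Let compat y c a b : W y -> 'D_('e_c) (fun z => G z a b) y =
  ip (G y) (Gam y c a) 'e_b + ip (G y) 'e_a (Gam y c b).
Proof.
by move=> Wy; rewrite -(metric_compat D c a b (domW Wy)) pd_crdV.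
Qed.

Let covdE c (Y : N -> 'rV[R]_m.+1) y : W y ->
  covd D d c Y (crdV (chart_of d) y) =
  \row_a 'D_('e_c) (fun z => Y (crdV (chart_of d) z) 0 a) y
  + \sum_a Y (crdV (chart_of d) y) 0 a *: Gam y c a.
Proof.
move=> Wy; rewrite /covd; congr (_ + _); apply/rowP => a; rewrite !mxE.
by rewrite pd_crdV.
Qed.

Let covd_endoE c (A : N -> 'M[R]_m.+1) y a : W y ->
  covd_endo D d c A (crdV (chart_of d) y) a =
  \row_b 'D_('e_c) (fun z => A (crdV (chart_of d) z) a b) y
  + \sum_b A (crdV (chart_of d) y) a b *: Gam y c b
  - Gam y c a *m A (crdV (chart_of d) y).
Proof.
move=> Wy; rewrite /covd_endo covdE //; congr (_ + _ - _).
  apply/rowP => b; rewrite [LHS]mxE [RHS]mxE; congr ('D_('e_c) _ y).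
  by apply/funext => z; rewrite mxE.
by apply: eq_bigr => b _; rewrite mxE.
Qed.

(** The common interface of the two kinds of structure: what the coordinate argument on umbilical
    hypersurfaces asks of [B] and [eta]. *)
Definition fundamental_forms (B : 'rV[R]_m.+1 -> 'M[R]_m.+1)
    (eta : 'rV[R]_m.+1 -> 'rV[R]_m.+1) : Prop :=
  [/\ forall a b, smooth_on W (fun y => B y a b),
      forall a, smooth_on W (fun y => eta y 0 a),
      forall y, W y -> (B y)^T = - B y,
      forall y w, W y -> dot w (eta y) = 0 -> w *m B y = 0 -> w = 0 &
      (forall y c a b, W y -> 'D_('e_c) (fun z => B z a b) y =
        ip (B y) (Gam y c a) 'e_b + ip (B y) 'e_a (Gam y c b)
        + (G y c a * eta y 0 b - eta y 0 a * G y c b)) /\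
      ((forall y, W y -> eta y = 0) \/
       (forall y c a, W y -> 'D_('e_c) (fun z => eta z 0 a) y =
         dot (Gam y c a) (eta y) - B y c a))].

(** With [xi] equal to 0, the equations J J = - 1 and nabla J = 0 are instances of [A_sqr] and
    [A_covd]. *)
Lemma kahler_fundamental_forms : kahler D -> exists B eta, fundamental_forms B eta.
Proof.
case=> J [Js _ Jsqr Jorth Jpar].
pose A := at_chart J; pose xi (_ : 'rV[R]_m.+1) : 'rV[R]_m.+1 := 0.
have A_smooth a b : smooth_on W (fun y => A y a b) by exact: smooth_W (Js d a b).
have AA y : W y -> A y *m A y = - 1%:M by move=> /domW/Jsqr.
have A_sqr y w : W y -> w *m A y *m A y = - w + ip (G y) (xi y) w *: xi y.
  by move=> Wy; rewrite -mulmxA AA // mulmxN mulmx1 scaler0 addr0.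
have A_covd y c a : W y ->
    \row_b 'D_('e_c) (fun z => A z a b) y + \sum_b A y a b *: Gam y c b
    - Gam y c a *m A y = G y c a *: xi y - ip (G y) (xi y) 'e_a *: 'e_c.
  move=> Wy; rewrite -covd_endoE // Jpar; last exact: domW.
  by rewrite scaler0 /xi ip0l scale0r subr0.
exists (fun y => A y *m G y), (fun y => xi y *m G y); split.
- move=> a b k; under eq_fun do rewrite mxE.
  apply: Ck_sum => // e; apply: Ck_mul => //; first exact: A_smooth.
  exact: G_smooth.
- move=> a k; under eq_fun do rewrite mul0mx mxE; exact: Ck_cst.
(* Multiplying the orthogonality relation by the transpose of [A] on the right and using A A = - 1
   gives skewness. *)
- move=> y Wy; have AGA : A y *m G y *m (A y)^T = G y by exact/Jorth/domW.
  rewrite trmx_mul G_sym // -{1}AGA -(mulmxA _ _^T) -trmx_mul AA //.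
  by rewrite linearN /= trmx1 mulmxN mulmx1.
- by move=> y w; exact: structure_nondeg.
- split; last by left=> y Wy; exact: mul0mx.
  move=> y c a b Wy; apply: structure_B_derive => // e.
  exact: Ck_derivable (A_smooth a e 1%N) Wy.
Qed.

Lemma sasakian_fundamental_forms : sasakian D -> exists B eta, fundamental_forms B eta.
Proof.
case=> xi0 [xs _ _ xkill xsqr xcov].
pose A := at_chart (sasaki_phi D xi0); pose xi := at_chart xi0.
have xi_smooth a : smooth_on W (fun y => xi y 0 a) by exact: smooth_W (xs d a).
have A_sqr y w : W y -> w *m A y *m A y = - w + ip (G y) (xi y) w *: xi y.
  by move=> Wy; exact/xsqr/domW.
have A_covd y c a : W y ->
    \row_b 'D_('e_c) (fun z => A z a b) y + \sum_b A y a b *: Gam y c b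
    - Gam y c a *m A y = G y c a *: xi y - ip (G y) (xi y) 'e_a *: 'e_c.
  by move=> Wy; rewrite -covd_endoE // xcov ?ip_ebase //; exact: domW.
have rowA y c : row c (A y) = - covd D d c (xi0 d) (crdV (chart_of d) y).
  by rewrite /A /at_chart /sasaki_phi linearN /= rowK.
have xi_covd y c : W y ->
    \row_a 'D_('e_c) (fun z => xi z 0 a) y + \sum_a xi y 0 a *: Gam y c a
    = - row c (A y).
  by move=> Wy; rewrite rowA opprK covdE.
(* The rows of [A] are - nabla xi, so skewness of [B] is the Killing equation. *)
have B_skew y : W y -> (A y *m G y)^T = - (A y *m G y).
  move=> Wy; apply/matrixP => i j; rewrite [LHS]mxE [RHS]mxE.
  have E k l : (A y *m G y) k l =
      - ip (G y) (covd D d k (xi0 d) (crdV (chart_of d) y)) 'e_l.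
    by rewrite -ip_ebase ip_mulmx -rowE rowA -scaleN1r ipZl mulN1r.
  rewrite !E opprK; apply/eqP; rewrite eq_sym -addr_eq0; apply/eqP.
  have := xkill d (crdV (chart_of d) y) i j (domW Wy).
  by rewrite [ip _ 'e_i _]ip_sym //; exact: G_sym.
have B_smooth a b : smooth_on W (fun y => (A y *m G y) a b).
  by apply: (structure_B_smooth (Gam := Gam) (xi := xi)).
exists (fun y => A y *m G y), (fun y => xi y *m G y); split => //.
- exact: lower_smooth.
- by move=> y w; exact: structure_nondeg.
- split; last by right=> y c a Wy; by apply: structure_eta_derive.
  move=> y c a b Wy; apply: structure_B_derive => // e.
  by apply: (structure_A_derivable (G := G) (Gam := Gam) (xi := xi)) => //; exact: Wo.
Qed.

End ChartStructure.

(** * Reduction of the global statement to coordinates *)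

Theorem corollary1p3 (R : realType) (m : nat) (m_ge4 : (4 <= m)%N)
    (N : manifold R m.+1) (g : metric N) (D : levi_civita g)
    (ND : kahler D \/ sasakian D)
    (M : manifold R m) (F : M -> N)
    (M_hyp : hypersurface F) (M_conn : connected [set: M]%classic)
    (M_umb : totally_umbilical D F) :
  constant_mean_curvature D F.
Proof.
move=> U nu II Unu Wnu c p i Up cp.
(* The chart of M is imposed by the goal; only a chart of N around [F p] is to be chosen. *)
have [d dFp] := atlas_cover (F p).
set cc := chart_of c in cp *; set dd := chart_of d in dFp *.
have [B [eta [Bs es Bskew nondeg [BD eD]]]] : exists B eta, fundamental_forms D d B eta.
  by case: ND; [exact: kahler_fundamental_forms|exact: sasakian_fundamental_forms].
have UFo : open (U `&` F @^-1` dom dd).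
  apply: openI; first exact: normal_open Unu.
  by apply: open_comp; [move=> q _; exact: hyp_continuous|exact: dom_open].
(* The coordinates of those points where the normal is defined and whose image under [F] lies in the
   chart [d]. *)
pose V := cod cc `&` crdV cc @^-1` (U `&` F @^-1` dom dd).
pose Fh x := crd dd (F (crdV cc x)); pose nuh x := nu d (crdV cc x).
have FhK x : V x -> crdV dd (Fh x) = F (crdV cc x) by case=> _ [_ /crdK].
have tE x k : V x -> tangent Fh k x = row k (dmap F c d (crdV cc x)).
  move=> [cx _]; apply/rowP => a; rewrite [LHS]mxE [RHS]mxE [RHS]mxE.
  by rewrite pd_crdV.
apply: (umbilical_constant (V := V) (W := cod dd) (F := Fh) (nu := nuh)
  (G := fun y => g d (crdV dd y)) (B := B) (eta := eta)
  (Gam := fun y => christ D d (crdV dd y))) => //.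
- exact: open_chart_preimage.
- exact: cod_open.
- by move=> x [_ [_ /crd_cod]].
- move=> a; apply: smooth_in_on (hyp_smooth M_hyp c d a).
  by move=> x [cx [_ Fx]].
- move=> a; apply: smooth_in_on (normal_smooth Unu c d a).
  by move=> x [].
- by move=> y a b Wy; exact/torsion_free/crdV_dom.
- by move=> y Wy; exact/metr_sym/crdV_dom.
- move=> x Vx; have [cx [_ Fx]] := Vx.
  have -> : \matrix_k tangent Fh k x = dmap F c d (crdV cc x).
    by apply/row_matrixP => k; rewrite rowK tE.
  by apply: (hyp_immersion M_hyp) => //; exact: crdV_dom.
- move=> x k Vx; have [cx [Ux Fx]] := Vx; rewrite tE // FhK //.
  by apply: (normal_orth Unu) => //; exact: crdV_dom.
(* The Weingarten equation for the k-th basis vector, on which umbilicity replaces [II] by the mean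
   curvature. *)
- move=> x k Vx; have [cx [Ux Fx]] := Vx; have dx := crdV_dom cx.
  have := Wnu c d _ k Ux dx Fx.
  rewrite rowE (M_umb U nu II Unu Wnu) // -scalemxAl -rowE -tE //.
  move=> /(congr1 -%R); rewrite opprK => ->.
  rewrite /along /covd_along /connection_form FhK //; congr (_ + _).
    by apply/rowP => a; rewrite [LHS]mxE [RHS]mxE pd_crdV.
  apply: eq_bigr => a _; apply: eq_bigr => b _.
  by rewrite tE // mxE.
- by split; [exact: crd_cod|rewrite /= crdK].
Qed.
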